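(* Let $k$ be a field with algebraic closure $\overline{k}$, let $d\in\mathbb{N}$, and let $f\in k\langle x_1,\dots,x_d\rangle\setminus k$ be a nonconstant noncommutative polynomial. If $f$ is not composite over $k$, then $f-\lambda$ is irreducible over $\overline{k}$ for all but finitely many $\lambda\in\overline{k}$.
   Context: $k\langle x_1,\dots,x_d\rangle$ denotes the free associative (unital) $k$-algebra in freely noncommuting variables $x_1,\dots,x_d$; its elements are called noncommutative polynomials. A nonconstant $f\in k\langle x_1,\dots,x_d\rangle$ is composite over $k$ if there exist $h\in k\langle x_1,\dots,x_d\rangle$ and a univariate polynomial $p\in k[t]$ with $\deg p>1$ such that $f=p(h)$. For a field $K$, an element $g\in K\langle x_1,\dots,x_d\rangle$ factors in $K\langle x_1,\dots,x_d\rangle$ if $g=g_1g_2$ for some nonconstant $g_1,g_2\in K\langle x_1,\dots,x_d\rangle$; otherwise $g$ is irreducible over $K$. Here $f-\lambda$ is viewed as an element of $\overline{k}\langle x_1,\dots,x_d\rangle$. *)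

(* Defs.v *)
From HB Require Import structures.
From mathcomp Require Import all_boot all_order all_algebra.
From mathcomp.multinomials Require Export monalg.

Set Implicit Arguments.
Unset Strict Implicit.
Unset Printing Implicit Defensive.

Import GRing.Theory.
Local Open Scope ring_scope.

(* The free associative algebra k<x_1, ..., x_d> is the monoid algebra over k
   of the free monoid on 'I_d (words in d letters). *)
Notation ncpoly k d := {malg k[{fmonom 'I_d}]}.

Section NCPoly.
Context {k : fieldType} {d : nat}.
Implicit Types (f g h : ncpoly k d) (p : {poly k}).

(* c%:MP is c times the empty word. *)
Definition nonconstant g : Prop := ~ exists c : k, g = c%:MP.

(* p(h), i.e. \sum_i p`_i *: h ^+ i.  This is what horner_alg h p unfolds to;
   horner_alg itself needs an algType, an instance that monalg only provides
   for commutative monoids. *)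
Definition nc_eval p h : ncpoly k d := (map_poly (in_alg (ncpoly k d)) p).[h].

(* deg p > 1 reads 2 < size p. *)
Definition composite f : Prop :=
  nonconstant f /\ exists h p, (2 < size p)%N /\ f = nc_eval p h.

Definition factors g : Prop :=
  exists g1 g2, [/\ nonconstant g1, nonconstant g2 & g = g1 * g2].

Definition nc_irreducible g : Prop := ~ factors g.

End NCPoly.

(* Extension of scalars: applies iota to every coefficient and fixes the words. *)
Definition nc_map {k K : fieldType} {d : nat} (iota : {rmorphism k -> K})
    (g : ncpoly k d) : ncpoly K d :=
  mmap (fun c => (iota c)%:MP) (fun m => << m >>) g.

(* Main.v *)
(* Suppose that f - lambda factors for infinitely many lambda.  Sorting the
   factorizations by the top words of their factors and normalizing, one gets
   f - lambda = a_lambda b_lambda with bounded degrees for infinitely many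
   lambda.  By the Dedekind-Mertens argument, multiplication by a coefficient of
   a_lambda preserves, up to polynomials in lambda, the span of the products of
   q coefficients of a_lambda.  Hence a_lambda and b_lambda come from
   matrices A, B over K<x>, K = kbar(t), such that A B = f - t and A has a
   scalar top coefficient.  By Gauss's lemma f - t is irreducible over K.
   If the centralizer of f were kbar[f], then the eigenring of f - t over K
   would be K (left substitution of f for t turns the idealizer of f - t into
   the centralizer of f), and the weak algorithm would force either f - t to
   divide A, or A to map some vector to a nonzero constant one; both contradict
   the shape of the top coefficient of A.  So f has a centralizer larger than
   kbar[f] over kbar, hence one larger than k[f] over k.

   The rest is Bergman's centralizer theorem.  Let C be a commutative subring
   containing k, with smallest positive difference of degrees delta, attained
   by c1 and c2.  Over the fractions of C, the commuting elements c1 - [c1] and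
   c2 - [c2], where [c] is c seen as a scalar, have a common left factor a;
   its nonconstant coefficients are integral and of degree at most 0, hence lie
   in k, so a = h - scalar, with h of degree at most delta commuting with C.
   Thus f is a polynomial in an element h of minimal degree in its centralizer,
   which is linear when f is not composite; then the centralizer is k[f]. *)

Require Import Defs.
From HB Require Import structures.
From mathcomp Require Import all_boot all_order all_algebra.
From mathcomp Require Import ring zify.
From mathcomp Require Import finmap perm.
From Stdlib Require Import Classical ClassicalEpsilon.

Set Implicit Arguments.
Unset Strict Implicit.
Unset Printing Implicit Defensive.

Import Order.TTheory GRing.Theory Num.Theory.
Local Open Scope ring_scope.

(* The factorizations of f - lambda for distinct lambda are unrelated and the lambda form an
   arbitrary infinite set, so a factorization over K, or over an extension of K, cannot be read off
   directly. What the factorizations share is linear: the relations, polynomial in lambda, between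
   the products of q coefficients of a_lambda. Here q is one less than the number of words up to a
   common length bound, so that one exponent suits every b_lambda. The quotient of a power of K by
   these relations is nonzero, because the q-th power of one top coefficient is a nonzero constant.
   It plays the part of a finite extension of K in which the coefficients of a_lambda would live,
   and this is why A and B are matrices. Irreducibility of f - t over K alone does not exclude such
   a factorization, whence the condition on the eigenring.

   The same content argument returns in the centralizer theorem, over the fractions of C: it bounds
   the denominators of all powers of a coefficient of the common left factor, and this is the sense
   of integrality used there. For C the bicommutant of two commuting elements is taken. *)
Reserved Notation "g @@ w" (at level 3, w at next level, format "g @@ w").

(* Sealed, since unification otherwise unfolds monoid algebras to finite maps. *)
HB.lock Definition freealg (I : choiceType) (E : nzRingType) : nzRingType :=
  {malg E[{fmonom I}]}.

(** Sealing leaves only an equation between the two rings. Transport along it gives inverse ring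
    morphisms, by destructing the equation. *)
Definition ring_cast (S T : nzRingType) (e : S = T) (x : S) : T :=
  match e in _ = T return T with erefl => x end.

Section RingCast.
Variables (S T : nzRingType) (e : S = T).

Lemma ring_castK : cancel (ring_cast e) (ring_cast (esym e)).
Proof. by case: T / e. Qed.

Lemma ring_castVK : cancel (ring_cast (esym e)) (ring_cast e).
Proof. by case: T / e. Qed.

Fact ring_cast_is_additive : additive (ring_cast e).
Proof. by case: T / e. Qed.

HB.instance Definition _ :=
  GRing.isAdditive.Build S T (ring_cast e) ring_cast_is_additive.

Fact ring_cast_is_multiplicative : multiplicative (ring_cast e).
Proof. by case: T / e. Qed.

HB.instance Definition _ :=
  GRing.isMultiplicative.Build S T (ring_cast e) ring_cast_is_multiplicative.

End RingCast.

(** * Coefficients and degrees in the free algebra *)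

Section Coefficients.
Variables (I : choiceType) (E : nzRingType).
Local Notation R := (freealg I E).
Local Notation M := {malg E[{fmonom I}]}.
Implicit Types (a b g : R) (u v w : seq I) (c : E).

Let unlockR : R = (M : nzRingType) :> nzRingType := congr1 (fun F => F I E) freealg.unlock.

Definition to_malg : R -> M := ring_cast unlockR.
Definition of_malg : M -> R := ring_cast (esym unlockR).

HB.instance Definition _ := GRing.RMorphism.on to_malg.
HB.instance Definition _ := GRing.RMorphism.on of_malg.

Lemma to_malgK : cancel to_malg of_malg. Proof. exact: ring_castK. Qed.
Lemma of_malgK : cancel of_malg to_malg. Proof. exact: ring_castVK. Qed.

Definition nccoef w a : E := mcoeff (FMonom w) (to_malg a).
Local Notation "g @@ w" := (nccoef w g).

HB.instance Definition _ w := GRing.Additive.copy (nccoef w)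
  (mcoeff (FMonom w) \o to_malg).

Definition ncmon c u : R := of_malg << c *g FMonom u >>.
Definition ncC c : R := of_malg c%:MP.
HB.instance Definition _ := GRing.RMorphism.copy ncC
  ((of_malg : M -> R) \o @malgC {fmonom I} E).

Definition words a : seq (seq I) := [seq fmonom_val m | m <- msupp (to_malg a)].

Lemma ncP a b : (forall w, a@@w = b@@w) <-> a = b.
Proof.
split=> [h|->//]; apply: (can_inj to_malgK); apply/malgP => -[w]; exact: h.
Qed.

Lemma ncmonE a : a = \sum_(u <- words a) ncmon a@@u u.
Proof.
apply: (can_inj to_malgK); rewrite [LHS]monalgE raddf_sum big_map.
by apply: eq_bigr => -[u] _ /=; rewrite /ncmon of_malgK.
Qed.

Lemma coef_mon c u w : (ncmon c u)@@w = c *+ (u == w).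
Proof. by rewrite /nccoef /ncmon of_malgK mcoeffU fmP. Qed.

Lemma nccoefC c w : (ncC c)@@w = c *+ (w == [::]).
Proof. by rewrite /nccoef /ncC of_malgK mcoeffC fmP fm1. Qed.

Lemma nccoef1 w : (1 : R)@@w = (w == [::])%:R.
Proof. by rewrite -(rmorph1 ncC) nccoefC. Qed.

Lemma nccoef0 w : (0 : R)@@w = 0. Proof. exact: raddf0. Qed.
Lemma nccoefD w a b : (a + b)@@w = a@@w + b@@w. Proof. exact: raddfD. Qed.
Lemma nccoefB w a b : (a - b)@@w = a@@w - b@@w. Proof. exact: raddfB. Qed.

Lemma nccoef_sum (J : Type) (r : seq J) (P : pred J) (F : J -> R) w :
  (\sum_(j <- r | P j) F j)@@w = \sum_(j <- r | P j) (F j)@@w.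
Proof. exact: raddf_sum. Qed.

Lemma words_uniq a : uniq (words a).
Proof. by rewrite map_inj_uniq ?fset_uniq // => -[u] [v] /= ->. Qed.

Lemma mem_words a w : (w \in words a) = (a@@w != 0).
Proof.
rewrite /nccoef mcoeff_neq0; apply/mapP/idP => [[[u] um ->] //|wm].
by exists (FMonom w).
Qed.

Lemma ncmonM c e u v : ncmon c u * ncmon e v = ncmon (c * e) (u ++ v).
Proof.
rewrite -rmorphM malgM_def fgmulUU; congr (of_malg << _ *g _ >>).
by apply/eqP; rewrite fmP fmM.
Qed.

Lemma nccoefM a b w : (a * b)@@w =
  \sum_(i < (size w).+1) a@@(take i w) * b@@(drop i w).
Proof.
rewrite [a in LHS]ncmonE [b in LHS]ncmonE mulr_suml nccoef_sum.
transitivity (\sum_(i < (size w).+1)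
   (\sum_(u <- words a) ncmon a@@u u)@@(take i w) *
   (\sum_(v <- words b) ncmon b@@v v)@@(drop i w)); last first.
  by apply: eq_bigr => i _; rewrite -!ncmonE.
under [RHS]eq_bigr => i _ do rewrite nccoef_sum mulr_suml /=.
rewrite exchange_big /=; apply: eq_bigr => u _.
rewrite mulr_sumr nccoef_sum.
under [RHS]eq_bigr => i _ do rewrite nccoef_sum mulr_sumr /=.
rewrite exchange_big /=; apply: eq_bigr => v _.
rewrite ncmonM; under [RHS]eq_bigr => i _ do rewrite !coef_mon.
rewrite coef_mon; have [uvw|uvw] := eqVneq (u ++ v) w.
  subst w.
  have su : (size u < (size (u ++ v)).+1)%N by rewrite size_cat ltnS leq_addr.
  rewrite (bigD1 (Ordinal su)) //= take_size_cat // drop_size_cat //.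
  rewrite !eqxx !mulr1n big1 ?addr0 // => i ni.
  have [tu|] := eqVneq u (take i (u ++ v)); last by rewrite mulr0n mul0r.
  case/eqP: ni; apply/val_inj => /=.
  move/(congr1 size): tu; rewrite size_take_min => ->.
  by apply/esym/minn_idPl; rewrite -ltnS.
rewrite big1 // => i _.
have [tu|] := eqVneq u (take i w); last by rewrite mulr0n mul0r.
have [tv|] := eqVneq v (drop i w); last by rewrite mulr0n mulr0.
by case/eqP: uvw; rewrite tu tv cat_take_drop.
Qed.

Lemma nccoefCM c a w : (ncC c * a)@@w = c * a@@w.
Proof.
rewrite nccoefM (bigD1 ord0) //= take0 drop0 nccoefC eqxx mulr1n.
rewrite big1 ?addr0 // => -[[|i] //= ilt] _; rewrite nccoefC.
by case: w ilt => [|x w] // _; rewrite mul0r.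
Qed.

Lemma nccoefMC c a w : (a * ncC c)@@w = a@@w * c.
Proof.
rewrite nccoefM (bigD1 ord_max) //= take_size drop_size nccoefC eqxx mulr1n.
rewrite big1 ?addr0 // => i ni; rewrite nccoefC -size_eq0 size_drop subn_eq0.
case: leqP => le; last by rewrite mulr0.
by case/eqP: ni; apply/val_inj/eqP; rewrite eqn_leq -ltnS ltn_ord.
Qed.

(* nsize a is deg a + 1, and nsize 0 = 0. *)
Definition nsize a := mmeasure (@fdeg I) (to_malg a).

Lemma coef_nsize a w : (nsize a <= size w)%N -> a@@w = 0.
Proof. by move=> aw; apply/mcoeff_outdom/(@mmeasure_mnm_ge _ _ (@fdeg I)). Qed.

Lemma coef_neq0_size a w : a@@w != 0 -> (size w < nsize a)%N.
Proof. by rewrite ltnNge; apply: contra_neqN; apply: coef_nsize. Qed.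

Lemma nsize_eq0 a : (nsize a == 0%N) = (a == 0).
Proof. by rewrite /nsize mmeasure_eq0 (can2_eq to_malgK of_malgK) raddf0. Qed.

Lemma nsize0 : nsize 0 = 0%N. Proof. by apply/eqP; rewrite nsize_eq0. Qed.

Lemma nsize_gt0 a : (0 < nsize a)%N = (a != 0).
Proof. by rewrite lt0n nsize_eq0. Qed.

Lemma nsizeP a n : reflect (forall w, (n <= size w)%N -> a@@w = 0) (nsize a <= n)%N.
Proof.
apply: (iffP idP) => [an w nw|h]; first by rewrite coef_nsize // (leq_trans an).
rewrite /nsize mmeasureE big_seq.
elim/big_ind: _ => // [x y xn yn|[w]]; first by rewrite geq_max xn.
rewrite -mcoeff_neq0 => aw; rewrite leqNgt; apply/negP; rewrite ltnS => /h aw0.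
by rewrite -/(nccoef w a) aw0 eqxx in aw.
Qed.

Lemma nsize_attained a : a != 0 -> exists2 w, a@@w != 0 & size w = (nsize a).-1.
Proof.
move=> a0; case: (classic (exists2 w, a@@w != 0 & size w = (nsize a).-1)) => // h.
move: a0; rewrite -nsize_gt0 => a0.
suff : (nsize a <= (nsize a).-1)%N by rewrite -ltnS prednK // ltnn.
apply/nsizeP => w; rewrite leq_eqVlt => /predU1P[sw|]; last first.
  by rewrite prednK //; apply: coef_nsize.
by apply/eqP/negPn/negP => aw; apply: h; exists w.
Qed.

Lemma nsizeN a : nsize (- a) = nsize a. Proof. by rewrite /nsize raddfN mmeasureN. Qed.

Lemma nsizeD a b : (nsize (a + b) <= maxn (nsize a) (nsize b))%N.
Proof. by rewrite /nsize raddfD mmeasureD_le. Qed.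

Lemma nsizeB a b : (nsize (a - b) <= maxn (nsize a) (nsize b))%N.
Proof. by rewrite -(nsizeN b) nsizeD. Qed.

Lemma nsizeC c : nsize (ncC c) = (c != 0). Proof. by rewrite /nsize /ncC of_malgK mmeasureC. Qed.

Lemma nsize_le1P a : reflect (exists c, a = ncC c) (nsize a <= 1)%N.
Proof.
apply: (iffP idP) => [a1|[c ->]]; last by rewrite nsizeC leq_b1.
exists a@@[::]; apply/ncP => w; rewrite nccoefC.
by case: w => // x w; rewrite coef_nsize // (leq_trans a1).
Qed.

(** Any other cut of [u ++ v] hands one factor a word beyond its degree bound, so only the cut
    between [u] and [v] contributes. *)
Lemma coefM_top a b u v :
  (nsize a <= (size u).+1)%N -> (nsize b <= (size v).+1)%N ->
  (a * b)@@(u ++ v) = a@@u * b@@v.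
Proof.
move=> au bv; rewrite nccoefM.
have su : (size u < (size (u ++ v)).+1)%N by rewrite size_cat ltnS leq_addr.
rewrite (bigD1 (Ordinal su)) //= take_size_cat // drop_size_cat //.
rewrite big1 ?addr0 // => -[i /= ilt]; rewrite -val_eqE /= => ni.
rewrite size_cat in ilt; have [lt|lt|/eqP] := ltngtP i (size u); last by rewrite (negPf ni).
  by rewrite [X in _ * X]coef_nsize ?mulr0 // size_drop size_cat; lia.
by rewrite coef_nsize ?mul0r // size_take_min size_cat; lia.
Qed.

Lemma nsizeM_le a b : (nsize (a * b) <= (nsize a + nsize b).-1)%N.
Proof.
apply/nsizeP => w sw; rewrite nccoefM big1 // => i _.
have [ai|ai] := leqP (nsize a) i.
  rewrite coef_nsize ?mul0r // size_take_min leq_min ai.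
  by rewrite (leq_trans ai) // -ltnS.
by rewrite [X in _ * X]coef_nsize ?mulr0 // size_drop; lia.
Qed.

End Coefficients.

Notation "g @@ w" := (nccoef w g) : ring_scope.
Arguments ncC {I E} c.
Arguments ncmon {I E} c u.

Section IntegralCoefficients.
Variables (I : choiceType) (E : idomainType).
Implicit Types (a b g : freealg I E) (u v w : seq I).

Lemma nsizeM a b : a != 0 -> b != 0 -> nsize (a * b) = (nsize a + nsize b).-1.
Proof.
move=> a0 b0; apply/eqP; rewrite eqn_leq nsizeM_le /=.
have [u au su] := nsize_attained a0; have [v bv sv] := nsize_attained b0.
have : (a * b)@@(u ++ v) != 0.
  by rewrite coefM_top ?mulf_neq0 // ?su ?sv prednK ?nsize_gt0.
move/coef_neq0_size; rewrite size_cat su sv.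
by move: a0 b0; rewrite -!nsize_gt0; lia.
Qed.

Lemma nc_mulf_eq0 a b : (a * b == 0) = (a == 0) || (b == 0).
Proof.
have [->|a0] := eqVneq a 0; first by rewrite mul0r eqxx.
have [->|b0] := eqVneq b 0; first by rewrite mulr0 eqxx.
rewrite -nsize_eq0 nsizeM //; move: a0 b0; rewrite -!nsize_gt0.
by case: (nsize a) => // m; case: (nsize b) => // n; rewrite addnS.
Qed.

Lemma nc_mulf_neq0 a b : a != 0 -> b != 0 -> a * b != 0.
Proof. by rewrite nc_mulf_eq0 negb_or => -> ->. Qed.

Lemma nc_mulfI a : a != 0 -> injective ( *%R a).
Proof.
move=> a0 b c /eqP; rewrite -subr_eq0 -mulrBr nc_mulf_eq0 (negPf a0) subr_eq0.
by move/eqP.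
Qed.

Lemma nc_mulC c a : ncC c * a = a * ncC c.
Proof. by apply/ncP => w; rewrite nccoefCM nccoefMC mulrC. Qed.

Lemma nsizeCM c a : c != 0 -> nsize (ncC c * a) = nsize a.
Proof.
move=> c0; have [->|a0] := eqVneq a 0; first by rewrite mulr0.
by rewrite nsizeM // -?nsize_eq0 nsizeC c0.
Qed.

End IntegralCoefficients.

(** * The weak algorithm *)

Section Transduction.
Variables (I : choiceType) (E : nzRingType).
Implicit Types (a b g : freealg I E) (u v w : seq I).

(** Cohn's transduction along [v]: the words ending in [v] are kept and stripped of that suffix, the
    others are dropped. *)
Definition rtrans v g : freealg I E :=
  \sum_(u <- words g | suffix v u) ncmon g@@u (take (size u - size v) u).

Lemma coef_rtrans v g w : (rtrans v g)@@w = g@@(w ++ v).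
Proof.
rewrite [in RHS](ncmonE g) /rtrans !nccoef_sum [LHS]big_mkcond /=.
apply: eq_bigr => u _; rewrite !coef_mon.
case: ifP => [/suffixP[u' ->]|vm]; last first.
  by case: eqP vm => // ->; rewrite suffix_suffix.
rewrite size_cat addnK take_size_cat //; congr (_ *+ nat_of_bool _).
have [uw|uw] := eqVneq (size u') (size w); first by rewrite eqseq_cat // eqxx andbT.
apply/eqP/eqP => e; first by rewrite e eqxx in uw.
by move/(congr1 size)/eqP: e; rewrite !size_cat eqn_add2r (negPf uw).
Qed.

(** The cuts falling in [w] give [a] times the transduction of [b]; those inside [v] are error
    terms, which degree bounds remove in the applications. *)
Lemma coefM_cat a b w v : (a * b)@@(w ++ v) =
  (a * rtrans v b)@@w + \sum_(i < size v) a@@(w ++ take i.+1 v) * b@@(drop i.+1 v).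
Proof.
rewrite !nccoefM -(big_mkord xpredT (fun i => a@@(take i (w ++ v)) * b@@(drop i (w ++ v)))).
rewrite size_cat -addSn (big_cat_nat (n := (size w).+1)) ?leq_addr //=.
congr (_ + _).
  rewrite big_mkord; apply: eq_bigr => i _.
  rewrite coef_rtrans take_cat drop_cat; case: ltnP => [//|iw].
  have -> : i = size w :> nat by apply/eqP; rewrite eqn_leq iw -ltnS ltn_ord.
  by rewrite subnn take0 drop0 take_size drop_size cats0.
rewrite -{1}[(size w).+1]add0n big_addn addKn big_mkord.
apply: eq_bigr => i _; rewrite take_cat drop_cat ltnNge.
have -> : (size w <= i + (size w).+1)%N by lia.
by rewrite (_ : i + _ - _ = i.+1)%N //; lia.
Qed.

End Transduction.

Section RowReduction.
Variables (R : nzRingType) (sz : R -> nat).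
Hypothesis mulR_eq0 : forall a b : R, (a * b == 0) = (a == 0) || (b == 0).
Hypothesis weakR : forall (J : finType) (x y : J -> R),
  \sum_j x j * y j = 0 -> (exists j, x j * y j != 0) ->
  exists j0 (z : J -> R), z j0 = 0 /\ (sz (x j0 + \sum_j x j * z j) < sz (x j0))%N.

(** Induction on the total size of the entries: a nontrivial relation lets the weak algorithm shrink
    one entry by an elementary column operation, and when none is left the nonzero entries are right
    independent. *)
Lemma row_reduction_of N (x : 'rV[R]_N) : exists P Q : 'M[R]_N,
  [/\ P *m Q = 1%:M, Q *m P = 1%:M &
   forall y : 'cV_N, x *m P *m y = 0 -> forall j, (x *m P) 0 j * y j 0 = 0].
Proof.
have [n] := ubnP (\sum_j sz (x ord0 j)); elim: n x => // n IHn x lexn.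
case: (classic (exists y : 'cV_N, x *m y = 0 /\ exists j, x 0 j * y j 0 != 0)); last first.
  move=> ind; exists 1%:M, 1%:M; rewrite !mulmx1; split=> // y xy j.
  by apply/eqP/negPn/negP => xyj; apply: ind; exists y; split=> //; exists j.
case=> y [/matrixP/(_ 0 0)]; rewrite !mxE => xy /(weakR xy)[j0 [z [zj0 lt]]].
pose zc : 'cV[R]_N := \col_j z j.
pose Z := zc *m delta_mx 0 j0 : 'M[R]_N.
have ZE i j : Z i j = z i * (j == j0)%:R.
  by rewrite !mxE big_ord1 !mxE eqxx.
(* Since [z j0 = 0], [Z] squares to zero and the column operation [1 + Z] has inverse [1 - Z]. *)
have ZZ : Z *m Z = 0.
  apply/matrixP => i j; rewrite mxE big1 ?mxE // => l _.
  by rewrite !ZE; case: (eqVneq l j0) => [->|_]; rewrite ?zj0 ?mul0r !mulr0 ?mul0r.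
have E1 : (1%:M + Z) *m (1%:M - Z) = 1%:M.
  by rewrite mulmxDl mul1mx mulmxBr ZZ mulmx1 subr0 subrK.
have E2 : (1%:M - Z) *m (1%:M + Z) = 1%:M.
  by rewrite mulmxBl mul1mx mulmxDr ZZ mulmx1 addr0 addrK.
have [|P [Q [PQ QP ind]]] := IHn (x *m (1%:M + Z)).
  rewrite -ltnS; apply: leq_trans lexn; rewrite ltnS (bigD1 j0) //= [X in (_ < X)%N](bigD1 j0) //=.
  rewrite -addSn leq_add //.
    apply: leq_trans lt; rewrite ltnS mulmxDr mulmx1 mxE.
    rewrite (_ : (x *m Z) 0 j0 = \sum_j x 0 j * z j) // mxE.
    by apply: eq_bigr => j _; rewrite ZE eqxx mulr1.
  apply: leq_sum => j /negPf jj0; rewrite mulmxDr mulmx1 mxE.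
  rewrite (_ : (x *m Z) 0 j = 0) ?addr0 // mxE big1 // => i _.
  by rewrite ZE jj0 !mulr0.
exists ((1%:M + Z) *m P), (Q *m (1%:M - Z)); split.
- by rewrite mulmxA -(mulmxA _ P) PQ mulmx1 E1.
- by rewrite mulmxA -(mulmxA Q) E2 mulmx1 QP.
- by move=> y'; rewrite mulmxA; apply: ind.
Qed.

(** The relation survives the reduction of the row [(g1, g2)] and forces one reduced entry to
    vanish. The other entry generates the right ideal of [g1] and [g2], which yields both the Bezout
    expression and the two factorizations. *)
Lemma common_left_factor_of (g1 g2 y1 y2 : R) :
  g1 * y1 = g2 * y2 -> g1 * y1 != 0 ->
  exists a s1 s2 b1 b2, [/\ a = g1 * s1 + g2 * s2, g1 = a * b1 & g2 = a * b2].
Proof.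
move=> eqg g0.
pose x : 'rV[R]_(1 + 1) := row_mx g1%:M g2%:M.
pose y : 'cV[R]_(1 + 1) := col_mx y1%:M (- y2)%:M.
have xy : x *m y = 0.
  by rewrite mul_row_col !mul_scalar_mx !scale_scalar_mx eqg mulrN raddfN /= subrr.
have x1 : x 0 (lshift 1 0) = g1 by rewrite row_mxEl mxE eqxx mulr1n.
have x2 : x 0 (rshift 1 0) = g2 by rewrite row_mxEr mxE eqxx mulr1n.
have [P [Q [PQ QP ind]]] := row_reduction_of x.
have xPQ : x = x *m P *m Q by rewrite -mulmxA PQ mulmx1.
have dep : (x *m P) *m (Q *m y) = 0 by rewrite mulmxA -xPQ.
have y1N : Q *m y != 0.
  apply: contraNneq g0 => Qy; have : P *m (Q *m y) = 0 by rewrite Qy mulmx0.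
  rewrite mulmxA PQ mul1mx => /colP/(_ (lshift 1 0)); rewrite col_mxEu !mxE eqxx mulr1n.
  by move=> ->; rewrite mulr0.
have {y1N} [i yi] : exists i, (Q *m y) i 0 != 0.
  apply: NNPP => h; case/eqP: y1N; apply/colP => i; rewrite [RHS]mxE; apply/eqP/negPn/negP => yi.
  by apply: h; exists i.
have xi : (x *m P) 0 i = 0.
  by have /eqP := ind _ dep i; rewrite mulR_eq0 (negPf yi) orbF => /eqP.
have [j ji] : exists j : 'I_(1 + 1), forall l, l = j \/ l = i.
  by case: i {yi xi} => -[|[|i]] // h;
     [exists (rshift 1 0)|exists (lshift 1 0)] => -[[|[|l]]] // hl;
     [right|left|left|right]; apply/val_inj.
have [jNi|_] := eqVneq j i.
  case/eqP: g0; have : x = 0.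
    rewrite xPQ (_ : x *m P = 0) ?mul0mx //; apply/rowP => l; rewrite [RHS]mxE.
    by case: (ji l) => ->; rewrite ?jNi.
  by move/rowP/(_ (lshift 1 0)); rewrite x1 mxE => ->; rewrite mul0r.
have xE l : x 0 l = (x *m P) 0 j * Q j l.
  rewrite [in LHS]xPQ mxE (bigD1 j) //= big1 ?addr0 // => t.
  by case: (ji t) => ->; rewrite ?eqxx // xi mul0r.
exists ((x *m P) 0 j), (P (lshift 1 0) j), (P (rshift 1 0) j),
  (Q j (lshift 1 0)), (Q j (rshift 1 0)).
by rewrite -!xE x1 x2 mxE big_split_ord /= !big_ord1 x1 x2.
Qed.

End RowReduction.

Section WeakAlgorithm.
Variables (I : choiceType) (K : fieldType).
Local Notation R := (freealg I K).

(* Cohn's weak algorithm. *)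
Lemma weak_step (J : finType) (x y : J -> R) :
  \sum_j x j * y j = 0 -> (exists j, x j * y j != 0) ->
  exists j0 (z : J -> R), z j0 = 0 /\
    (nsize (x j0 + \sum_j x j * z j) < nsize (x j0))%N.
Proof.
move=> xy0 [j xyj].
have [s sE] : exists s, forall i, s i = nsize (x i * y i) by eexists=> i; exact: erefl.
have [a aE] : exists s, forall i, s i = nsize (x i) by eexists=> i; exact: erefl.
have [b bE] : exists s, forall i, s i = nsize (y i) by eexists=> i; exact: erefl.
have sab i : (0 < a i -> 0 < b i -> s i = (a i + b i).-1)%N.
  by rewrite aE bE sE !nsize_gt0; apply: nsizeM.
have s0ab i : (0 < s i -> (0 < a i) && (0 < b i))%N.
  by rewrite aE bE sE !nsize_gt0 nc_mulf_eq0 negb_or.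
have sj : (0 < s j)%N by rewrite sE nsize_gt0.
case: (@arg_maxnP _ j xpredT s) => // j1 _ max1.
case: (@arg_maxnP _ j1 (fun j => s j == s j1) a) => //= j0 /eqP s0 max0.
have /andP[x0 y0] : (0 < a j0)%N && (0 < b j0)%N.
  by apply: s0ab; rewrite s0; apply: leq_trans sj (max1 j isT).
have lexM i : (0 < a i -> 0 < b i -> (a i + b i <= a j0 + b j0) /\
    (a i + b i = a j0 + b j0 -> a i <= a j0))%N.
  move=> xi yi; have := max1 i isT; have := max0 i; rewrite -s0.
  by rewrite (sab _ xi yi) (sab _ x0 y0); lia.
have y0' : y j0 != 0 by rewrite -nsize_gt0 -bE.
have [v yv] := nsize_attained y0'; rewrite -bE => sv.
set c := (y j0)@@v in yv.
exists j0, (fun j => if j == j0 then 0 else rtrans v (y j) * ncC c^-1).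
rewrite eqxx; split=> //.
have tr0 : rtrans v (y j0) = ncC c.
  apply/ncP => w; rewrite coef_rtrans nccoefC; case: w => [|l w] //.
  by rewrite coef_nsize // -bE size_cat sv /=; lia.
rewrite -aE -(prednK x0) ltnS; apply/nsizeP => w sw.
have -> : \sum_j x j * (if j == j0 then 0 else rtrans v (y j) * ncC c^-1) =
    (\sum_(j | j != j0) x j * rtrans v (y j)) * ncC c^-1.
  rewrite mulr_suml [RHS]big_mkcond; apply: eq_bigr => i _.
  by case: eqP => _ /=; rewrite ?mulr0 ?mulrA.
apply/(mulIf yv); rewrite mul0r nccoefD nccoefMC mulrDl (mulfVK yv).
transitivity ((\sum_i x i * rtrans v (y i))@@w).
  by rewrite -nccoefMC -tr0 -nccoefD [in RHS](bigD1 j0).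
have := congr1 (fun g : R => g@@(w ++ v)) xy0; rewrite nccoef_sum nccoef0 /=.
under eq_bigr => i _ do rewrite coefM_cat.
rewrite big_split /= nccoef_sum [X in _ + X]big1 ?addr0 // => i _.
(* A nonzero error term would give a product of at least the maximal size whose left factor is
   larger than [x j0]. *)
rewrite big1 // => -[l /= lv] _; apply/eqP; apply/negPn/negP.
rewrite mulf_eq0 negb_or => /andP[xl yl].
move/coef_neq0_size: xl; move/coef_neq0_size: yl.
rewrite -aE -bE size_cat size_drop size_take_min => yl xl.
by have [] := lexM i (leq_trans _ xl) (leq_trans _ yl) => //; lia.
Qed.

Lemma row_reduction N (x : 'rV[R]_N) : exists P Q : 'M[R]_N,
  [/\ P *m Q = 1%:M, Q *m P = 1%:M &
   forall y : 'cV_N, x *m P *m y = 0 -> forall j, (x *m P) 0 j * y j 0 = 0].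
Proof. by apply: (@row_reduction_of _ (@nsize I K)); apply: weak_step. Qed.

Lemma common_left_factor (g1 g2 y1 y2 : R) :
  g1 * y1 = g2 * y2 -> g1 * y1 != 0 ->
  exists a s1 s2 b1 b2, [/\ a = g1 * s1 + g2 * s2, g1 = a * b1 & g2 = a * b2].
Proof.
apply: (@common_left_factor_of _ (@nsize I K)) => [a b|]; first exact: nc_mulf_eq0.
exact: weak_step.
Qed.

(** Transducing the relation along a top word of [y2] makes [g2], up to a scalar and terms of lower
    degree, a right multiple of [g1]. Subtracting this multiple lowers [g2] and keeps a common right
    multiple with [g1], so the step repeats. *)
Lemma division (g1 g2 y1 y2 : R) : g2 * y2 = g1 * y1 -> y2 != 0 -> g1 != 0 ->
  exists h, (nsize (g2 - g1 * h) < nsize g1)%N.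
Proof.
move=> eqg y20 g10; have [n] := ubnP (nsize g2).
elim: n g2 y1 eqg => // n IHn g2 y1 eqg sn.
have [lt|ge] := ltnP (nsize g2) (nsize g1); first by exists 0; rewrite mulr0 subr0.
have [v yv sv] := nsize_attained y20.
pose c := y2@@v; pose z := rtrans v y1 * ncC c^-1.
suff lt : (nsize (g2 - g1 * z) < nsize g2)%N.
  have [||h hlt] := IHn (g2 - g1 * z) (y1 - z * y2); first by rewrite mulrBl mulrBr eqg -mulrA.
    exact: leq_trans lt _.
  by exists (z + h); rewrite mulrDr opprD addrA.
have g2gt0 : (0 < nsize g2)%N by apply: leq_trans ge; rewrite nsize_gt0.
rewrite -(prednK g2gt0) ltnS; apply/nsizeP => w sw.
apply/(mulIf yv); rewrite mul0r.
have tr2 : rtrans v y2 = ncC c.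
  apply/ncP => u; rewrite coef_rtrans nccoefC; case: u => [|l u] //.
  by rewrite coef_nsize // size_cat sv; move: y20; rewrite -nsize_gt0 /=; lia.
have := congr1 (fun g : R => g@@(w ++ v)) eqg; rewrite !coefM_cat tr2 nccoefMC.
rewrite big1 ?addr0 => [|i _]; last first.
  by rewrite coef_nsize ?mul0r // size_cat size_take_min; have := ltn_ord i; lia.
rewrite [X in _ + X]big1 ?addr0 => [e|i _]; last first.
  by rewrite coef_nsize ?mul0r // size_cat size_take_min; have := ltn_ord i; lia.
by rewrite nccoefB mulrBl e /z mulrA nccoefMC (mulfVK yv) subrr.
Qed.

End WeakAlgorithm.

(** * Content modules *)

Section Monomials.
Variables (I : choiceType) (E : nzRingType).
Implicit Types (a b g : freealg I E) (u v w : seq I).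

Lemma coef_monM c u b w : (ncmon c u * b)@@w =
  if prefix u w then c * b@@(drop (size u) w) else 0.
Proof.
rewrite [b in LHS]ncmonE mulr_sumr nccoef_sum.
case: ifP => [/prefixP[v ->]|uw].
  rewrite drop_size_cat // [in RHS](ncmonE b) nccoef_sum mulr_sumr.
  by apply: eq_bigr => x _; rewrite ncmonM !coef_mon eqseq_cat // eqxx mulrnAr.
rewrite big1 // => x _; rewrite ncmonM coef_mon; case: eqP => // e.
by rewrite -e prefix_prefix in uw.
Qed.

Lemma coefMmon a c v w : (a * ncmon c v)@@w =
  if suffix v w then a@@(take (size w - size v) w) * c else 0.
Proof.
rewrite [a in LHS]ncmonE mulr_suml nccoef_sum.
case: ifP => [/suffixP[u ->]|vw].
  rewrite size_cat addnK take_size_cat // [in RHS](ncmonE a) nccoef_sum mulr_suml.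
  apply: eq_bigr => x _; rewrite ncmonM !coef_mon -mulrnAl.
  congr (_ *+ nat_of_bool _ * _); have [xu|xu] := eqVneq (size x) (size u).
    by rewrite eqseq_cat // eqxx andbT.
  apply/eqP/eqP => [|-> //]; move/(congr1 size)/eqP.
  by rewrite !size_cat eqn_add2r (negPf xu).
rewrite big1 // => x _; rewrite ncmonM coef_mon; case: eqP => // e.
by rewrite -e suffix_suffix in vw.
Qed.

End Monomials.

Section DedekindMertens.
Variables (I : choiceType) (E : comNzRingType) (J : Type).
Implicit Types (a b : J -> freealg I E) (H : (J -> E) -> Prop).
Implicit Types (S T s : seq (seq I)) (u v w : seq I).

Definition supported S a := forall j w, w \notin S -> (a j)@@w = 0.

(** Elements of content modules are functions of [j]. The list [s] may repeat words: the products
    with [size s = q] generate the q-th power of the content of the family. *)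
Definition coefprod a s j := \prod_(u <- s) (a j)@@u.

Lemma longest_word S : S != [::] ->
  exists2 u, u \in S & forall w, w \in S -> (size w <= size u)%N.
Proof.
elim: S => // u S IHS _; have [->|/IHS[v vS vmax]] := eqVneq S [::].
  by exists u; rewrite ?mem_head // => w; rewrite mem_seq1 => /eqP ->.
have [uv|vu] := leqP (size u) (size v).
  exists v; rewrite ?in_cons ?vS ?orbT // => w; rewrite in_cons.
  by case/predU1P => [->//|]; apply: vmax.
exists u; rewrite ?mem_head // => w; rewrite in_cons.
by case/predU1P => [->//|/vmax wv]; apply: leq_trans wv (ltnW vu).
Qed.

Lemma supported_nsize S a j u : supported S a ->
  (forall w, w \in S -> (size w <= size u)%N) -> (nsize (a j) <= (size u).+1)%N.
Proof.
move=> aS umax; apply/nsizeP => w uw; apply: aS; apply/negP => /umax.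
by rewrite leqNgt uw.
Qed.

Lemma supported_rem S a u : supported S a ->
  supported (filter (predC1 u) S) (fun j => a j - ncmon (a j)@@u u).
Proof.
move=> aS j w; rewrite mem_filter /= nccoefB coef_mon.
have [->|wu] := eqVneq w u; first by rewrite mulr1n subrr.
by rewrite subr0; apply: aS.
Qed.

Lemma size_filter_predC1 (K : eqType) (x : K) (s : seq K) :
  x \in s -> (size (filter (predC1 x) s) < size s)%N.
Proof.
move=> xs; rewrite size_filter -(count_predC (pred1 x) s) -[X in (X < _)%N]add0n.
by rewrite ltn_add2r -has_count has_pred1.
Qed.

Let dm_at q := forall S T a b H,
    (forall x y z, H x -> H y -> (forall j, z j = x j - y j) -> H z) ->
    supported S a -> supported T b -> (size T <= q.+1)%N ->
    (forall w s, size s = q -> H (fun j => coefprod a s j * (a j * b j)@@w)) ->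
  forall v s, size s = q.+1 -> H (fun j => coefprod a s j * (b j)@@v).

(** Inner induction on the support of [a]. Products containing the top coefficient of [a] are
    treated by deleting the top word of [b], which lowers [q]; the others by deleting the top word
    of [a]. The corrections are paid for by the identity [abE], where a single cut contributes. *)
Let dm_step q : q = 0%N \/ dm_at q.-1 -> dm_at q.
Proof.
move=> IHq S; have [p] := ubnP (size S).
elim: p S => // p IHp S sS T a b H HB aS bT sT Hab.
have H0 x : (forall j, x j = 0) -> H x.
  move=> x0; have Hx := Hab [::] (nseq q [::]) (size_nseq _ _).
  by apply: (HB _ _ _ Hx Hx) => j; rewrite x0 subrr.
have Heq x y : H x -> (forall j, x j = y j) -> H y.
  by move=> Hx xy; apply: (HB _ _ _ Hx (H0 (fun=> 0) (fun=> erefl))) => j; rewrite subr0.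
have [S0|S0] := eqVneq S [::].
  move=> v [|u s] // _; apply: H0 => j.
  by rewrite /coefprod big_cons aS ?S0 // !mul0r.
have [T0|T0] := eqVneq T [::].
  by move=> v s _; apply: H0 => j; rewrite bT ?T0 ?mulr0.
have [u0 u0S u0max] := longest_word S0; have [v0 v0T v0max] := longest_word T0.
have abE j : (a j * b j)@@(u0 ++ v0) = (a j)@@u0 * (b j)@@v0.
  by rewrite coefM_top //; [apply: supported_nsize aS u0max|apply: supported_nsize bT v0max].
have top v s : size s = q -> H (fun j => coefprod a (u0 :: s) j * (b j)@@v).
  move=> ss; have [->|vv0] := eqVneq v v0.
    by apply: Heq (Hab (u0 ++ v0) s ss) _ => j; rewrite /coefprod big_cons abE; ring.
  pose b' j := b j - ncmon (b j)@@v0 v0.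
  have b'E j : (b j)@@v = (b' j)@@v.
    by rewrite nccoefB coef_mon eq_sym (negPf vv0) subr0.
  have b'T : supported (filter (predC1 v0) T) b' by exact: supported_rem.
  have sT' := leq_trans (size_filter_predC1 v0T) sT.
  case: q IHq Hab sT' ss {sT IHp} => [_ _|q [//|IHq] Hab] sT' ss.
    (* For [q = 0] the word [v0] is the only one in [T], so [b'] vanishes. *)
    apply: H0 => j; rewrite b'E b'T ?mulr0 //.
    by move: sT'; rewrite ltnS leqn0 size_eq0 => /eqP ->.
  pose H' x := H (fun j => (a j)@@u0 * x j).
  suff HI : H' (fun j => coefprod a s j * (b' j)@@v).
    by apply: Heq HI _ => j; rewrite /coefprod big_cons b'E mulrA.
  apply: (IHq S _ a b' H' _ aS b'T sT' _ v s ss) => [x y z Hx Hy zE|w s' ss'].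
    by apply: HB Hx Hy _ => j; rewrite zE mulrBr.
  (* The deleted term of [b] brings the factor [(b j)@@v0]. Together with [(a j)@@u0] it forms the
     coefficient of the product at [u0 ++ v0]. *)
  pose t j := coefprod a (u0 :: s') j * (a j * ncmon (b j)@@v0 v0)@@w.
  have Ht : H t.
    rewrite /t; case: (boolP (suffix v0 w)) => vw; last first.
      by apply: H0 => j; rewrite coefMmon (negPf vw) mulr0.
    apply: Heq (Hab (u0 ++ v0) (take (size w - size v0) w :: s') _) _ => /=.
      by rewrite ss'.
    by move=> j; rewrite abE coefMmon vw /coefprod !big_cons; ring.
  apply: HB (Hab w (u0 :: s') _) Ht _ => [|j]; first by rewrite /= ss'.
  by rewrite /t mulrBr nccoefB /coefprod big_cons; ring.
move=> v s ss; case: (boolP (u0 \in s)) => [u0s|u0s].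
  apply: Heq (top v (rem u0 s) _) _ => [|j]; first by rewrite size_rem // ss.
  by rewrite /coefprod (perm_big _ (perm_to_rem u0s)).
pose a' j := a j - ncmon (a j)@@u0 u0.
have a'E s' j : u0 \notin s' -> coefprod a' s' j = coefprod a s' j.
  move=> u0s'; apply: eq_big_seq => u us'; rewrite nccoefB coef_mon.
  by case: eqP us' => [<-|_ _]; rewrite ?(negPf u0s') ?subr0.
have a'0 s' j : u0 \in s' -> coefprod a' s' j = 0.
  move=> u0s'; rewrite /coefprod (perm_big _ (perm_to_rem u0s')) big_cons.
  by rewrite /= nccoefB coef_mon eqxx mulr1n subrr mul0r.
suff HI : H (fun j => coefprod a' s j * (b j)@@v).
  by apply: Heq HI _ => j; rewrite a'E.
apply: (IHp (filter (predC1 u0) S) _ T a' b H) => //.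
- exact: leq_trans (size_filter_predC1 u0S) _.
- exact: supported_rem.
move=> w s' ss'; case: (boolP (u0 \in s')) => u0s'.
  by apply: H0 => j; rewrite a'0 // mul0r.
pose t j := coefprod a s' j * (ncmon (a j)@@u0 u0 * b j)@@w.
have Ht : H t.
  rewrite /t; case: (boolP (prefix u0 w)) => uw; last first.
    by apply: H0 => j; rewrite coef_monM (negPf uw) mulr0.
  apply: Heq (top (drop (size u0) w) s' ss') _ => j.
  by rewrite coef_monM uw /coefprod big_cons; ring.
by apply: HB (Hab w s' ss') Ht _ => j; rewrite a'E // mulrBl nccoefB mulrBr.
Qed.

(* The Dedekind-Mertens inclusion c(a)^(q+1) c(b) <= c(a)^q c(ab) of content
   modules, for a b with at most q+1 coefficients; H is an arbitrary additive
   group containing the right-hand side. *)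
Lemma dedekind_mertens q S T a b H :
    (forall x y z, H x -> H y -> (forall j, z j = x j - y j) -> H z) ->
    supported S a -> supported T b -> (size T <= q.+1)%N ->
    (forall w s, size s = q -> H (fun j => coefprod a s j * (a j * b j)@@w)) ->
  forall v s, size s = q.+1 -> H (fun j => coefprod a s j * (b j)@@v).
Proof.
suff dm : dm_at q by exact: dm.
by elim: q => [|q IHq]; apply: dm_step; [left|right].
Qed.

End DedekindMertens.

Section CoefficientMap.
Variables (I : choiceType) (E E' : nzRingType) (phi : {rmorphism E -> E'}).
Implicit Types (g : freealg I E).

Definition cmap g : freealg I E' := \sum_(u <- words g) ncmon (phi g@@u) u.

Lemma coef_cmap g w : (cmap g)@@w = phi g@@w.
Proof.
rewrite [in RHS](ncmonE g) !nccoef_sum rmorph_sum; apply: eq_bigr => u _.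
by rewrite !coef_mon rmorphMn.
Qed.

Fact cmap_is_additive : additive cmap.
Proof. by move=> a b; apply/ncP => w; rewrite nccoefB !coef_cmap nccoefB rmorphB. Qed.

HB.instance Definition _ :=
  GRing.isAdditive.Build (freealg I E) (freealg I E') cmap cmap_is_additive.

Fact cmap_is_multiplicative : multiplicative cmap.
Proof.
split=> [a b|]; apply/ncP => w; last by rewrite coef_cmap !nccoef1 rmorph_nat.
rewrite nccoefM coef_cmap nccoefM rmorph_sum; apply: eq_bigr => i _.
by rewrite rmorphM !coef_cmap.
Qed.

HB.instance Definition _ :=
  GRing.isMultiplicative.Build (freealg I E) (freealg I E') cmap
    cmap_is_multiplicative.

Lemma cmapC c : cmap (ncC c) = ncC (phi c).
Proof. by apply/ncP => w; rewrite coef_cmap !nccoefC rmorphMn. Qed.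

End CoefficientMap.

Lemma cmap_inj (I : choiceType) (E E' : nzRingType) (phi : {rmorphism E -> E'}) :
  injective phi -> injective (cmap (I := I) phi).
Proof.
move=> phi_inj a b ab; apply/ncP => w; apply: phi_inj.
by rewrite -!coef_cmap ab.
Qed.

Section TopDivision.
Variables (I : choiceType) (E : comNzRingType) (J : Type).
Variables (A : (J -> E) -> Prop) (a b : J -> freealg I E) (u0 : seq I) (mu : E).
Hypothesis A_eq : forall x y, A x -> (forall j, x j = y j) -> A y.
Hypothesis A0 : A (fun=> 0).
Hypothesis A_sub : forall x y, A x -> A y -> A (fun j => x j - y j).
Hypothesis A_mul : forall x y, A x -> A y -> A (fun j => x j * y j).
Hypothesis A_mu : A (fun=> mu).
Hypothesis a_mu : forall j, mu * (a j)@@u0 = 1.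
Hypothesis a_size : forall j, (nsize (a j) <= (size u0).+1)%N.
Hypothesis A_a : forall u, A (fun j => (a j)@@u).
Hypothesis A_ab : forall w, A (fun j => (a j * b j)@@w).

(** Descending induction on the length of [v]: the coefficient of the product at [u0 ++ v] is the
    invertible [(a j)@@u0] times [(b j)@@v], plus terms with longer words of [b]; cuts beyond [u0]
    exceed the degree of [a]. *)
Lemma top_division_closed n : (forall j, nsize (b j) <= n)%N ->
  forall v, A (fun j => (b j)@@v).
Proof.
have A_add x y : A x -> A y -> A (fun j => x j + y j).
  by move=> Ax Ay; apply: A_eq (A_sub Ax (A_sub A0 Ay)) _ => j; rewrite sub0r opprK.
have A_sum (L : Type) (r : seq L) (P : pred L) (F : L -> J -> E) :
    (forall l, P l -> A (F l)) -> A (fun j => \sum_(l <- r | P l) F l j).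
  move=> AF; elim: r => [|l r IHr]; first by apply: A_eq A0 _ => j; rewrite big_nil.
  case Pl: (P l); last by apply: A_eq IHr _ => j; rewrite big_cons Pl.
  by apply: A_eq (A_add _ _ (AF l Pl) IHr) _ => j; rewrite big_cons Pl.
move=> bn v; have [k] := ubnP (n - size v); elim: k v => // k IHk v vk.
have [nv|vn] := leqP n (size v).
  by apply: A_eq A0 _ => j; rewrite coef_nsize // (leq_trans (bn j)).
have su : (size u0 < (size (u0 ++ v)).+1)%N by rewrite size_cat ltnS leq_addr.
pose t (i : 'I_(size (u0 ++ v)).+1) j :=
  (a j)@@(take i (u0 ++ v)) * (b j)@@(drop i (u0 ++ v)).
have At i : i != Ordinal su -> A (t i).
  case: i => i /= ilt; rewrite -val_eqE /= => iu; rewrite /t /=.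
  have [lt|gt|/eqP] := ltngtP i (size u0); last by rewrite (negPf iu).
    apply: A_mul (A_a _) (IHk _ _); rewrite size_drop size_cat.
    by move: vk vn lt; lia.
  apply: A_eq A0 _ => j; rewrite coef_nsize ?mul0r //.
  by rewrite size_take_min (leq_trans (a_size j)) // leq_min gt (leq_trans gt).
apply: A_eq (A_mul A_mu (A_sub (A_ab (u0 ++ v)) (A_sum _ (index_enum _) _ _ At))) _.
move=> j; rewrite nccoefM (bigD1 (Ordinal su)) //= addrK.
by rewrite take_size_cat // drop_size_cat // mulrA a_mu mul1r.
Qed.

End TopDivision.

(** * Weights: degree of the coefficient plus length of the word *)

Section DegreeLike.
Variables (I : choiceType) (E : idomainType) (v : E -> int) (om : nat).
Hypothesis vM : forall x y : E, x != 0 -> y != 0 -> v (x * y) = v x + v y.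
Hypothesis vN : forall x : E, v (- x) = v x.
Hypothesis vD : forall (x y : E) (m : int), x != 0 -> y != 0 -> x + y != 0 ->
  v x <= m -> v y <= m -> v (x + y) <= m.
Implicit Types (a b g : freealg I E) (w : seq I) (m : int).

Definition vle (x : E) (m : int) := (x == 0) || (v x <= m).

Lemma vle_add x y m : vle x m -> vle y m -> vle (x + y) m.
Proof.
rewrite /vle; have [->|x0] := eqVneq x 0; first by rewrite add0r.
have [->|y0] := eqVneq y 0; first by rewrite addr0 (negPf x0).
by have [//|xy] := eqVneq (x + y) 0; apply: vD.
Qed.

Lemma vle_opp x m : vle (- x) m = vle x m.
Proof. by rewrite /vle oppr_eq0 vN. Qed.

Lemma vle_sum (L : Type) (r : seq L) (P : pred L) F m :
  (forall l, P l -> vle (F l) m) -> vle (\sum_(l <- r | P l) F l) m.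
Proof.
move=> Fm; apply: (big_ind (fun x => vle x m)) => //; first by rewrite /vle eqxx.
by move=> x y; apply: vle_add.
Qed.

Lemma vle_mul x y m m' : vle x m -> vle y m' -> vle (x * y) (m + m').
Proof.
rewrite /vle mulf_eq0; have [//|x0] := eqVneq x 0; have [//|y0 /=] := eqVneq y 0.
by rewrite vM //; lia.
Qed.

Lemma vle_trans x m m' : m <= m' -> vle x m -> vle x m'.
Proof. by rewrite /vle; case: eqP => //= _; lia. Qed.

(** With [om = 0] this bounds the degree of the scalars alone; with [om = 1], the total degree of
    scalars and words. *)
Definition wle g m := forall w, vle g@@w (m - (om * size w)%:Z).

Definition reaches g m w := (g@@w != 0) /\ v g@@w + (om * size w)%:Z = m.

Definition longest_reach g m w :=
  reaches g m w /\ forall w', reaches g m w' -> (size w' <= size w)%N.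

Lemma weight_exists g : g != 0 -> exists m w, wle g m /\ longest_reach g m w.
Proof.
move=> g0; pose f w : int := v g@@w + (om * size w)%:Z.
have : words g != [::].
  apply: contra_neq g0 => g0; apply/ncP => w; apply/eqP; rewrite nccoef0.
  by rewrite -[_ == _]negbK -mem_words g0.
have max (s : seq (seq I)) : s != [::] -> exists2 w, w \in s &
    forall w', w' \in s -> f w' < f w \/ f w' = f w /\ (size w' <= size w)%N.
  elim: s => // u s IHs _; have [->|/IHs[w ws wmax]] := eqVneq s [::].
    by exists u; rewrite ?mem_head // => w; rewrite mem_seq1 => /eqP ->; right.
  have [lt|ge] := boolP ((f u < f w) || (f u == f w) && (size u <= size w)%N).
    exists w; rewrite ?in_cons ?ws ?orbT // => w'; rewrite in_cons.
    case/predU1P => [->|/wmax //]; case/orP: lt => [|/andP[/eqP]]; by [left|right].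
  exists u; rewrite ?mem_head // => w'; rewrite in_cons.
  case/predU1P => [->|/wmax]; first by right.
  move: ge; move: (f u) (f w) (f w') => x y z.
  by case: (ltgtP x y) => //= [yx _|->]; rewrite -?ltnNge; lia.
case/max => w; rewrite mem_words => gw wmax; exists (f w), w; split.
  move=> w'; rewrite /vle; have [//|gw' /=] := eqVneq g@@w' 0.
  by move: (wmax w'); rewrite mem_words gw' /f => /(_ isT); lia.
split=> // w' [gw' fw']; move: (wmax w'); rewrite mem_words gw' => /(_ isT).
by case=> [|[]//]; rewrite /f fw' ltxx.
Qed.

(* At the concatenation of two longest words reaching the weight there is no
   cancellation. *)
Lemma weightM a b m m' u w :
    wle a m -> longest_reach a m u -> wle b m' -> longest_reach b m' w ->
  wle (a * b) (m + m') /\ reaches (a * b) (m + m') (u ++ w).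
Proof.
move=> am [[au aum] aumax] bm [[bw bwm] bwmax]; split=> [x|].
  rewrite nccoefM; apply: vle_sum => i _.
  apply: vle_trans (vle_mul (am _) (bm _)); rewrite size_take_min size_drop.
  by have := ltn_ord i; nia.
have su : (size u < (size (u ++ w)).+1)%N by rewrite size_cat ltnS leq_addr.
have [c [cE cle]] : exists c, (a * b)@@(u ++ w) = a@@u * b@@w + c /\
    vle c (v (a@@u * b@@w) - 1).
  rewrite nccoefM (bigD1 (Ordinal su)) //= take_size_cat // drop_size_cat //.
  eexists; split; first exact: erefl.
  apply: vle_sum => -[i /= ilt]; rewrite -val_eqE /= => iu.
  set x := take i _; set y := drop i _.
  have sx : size x = i by rewrite /x size_take_min; apply/minn_idPl; rewrite -ltnS.
  have sy : (size y + i = size u + size w)%N by rewrite size_drop size_cat in ilt *; lia.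
  have := am x; have := bm y; rewrite {1 2}/vle.
  have [->|ax] := eqVneq a@@x 0; first by rewrite mul0r /vle eqxx.
  have [->|b_y] := eqVneq b@@y 0; first by rewrite mulr0 /vle eqxx.
  move=> /= vb va; rewrite /vle mulf_eq0 (negPf ax) (negPf b_y) /= !vM //.
  have xu : (size u < size x)%N -> v a@@x + (om * size x)%:Z <> m.
    by move=> lt e; have := aumax x (conj ax e); rewrite leqNgt lt.
  have yw : (size w < size y)%N -> v b@@y + (om * size y)%:Z <> m'.
    by move=> lt e; have := bwmax y (conj b_y e); rewrite leqNgt lt.
  have [lt|gt|/eqP] := ltngtP i (size u); last by rewrite (negPf iu).
    by have := yw; nia.
  by have := xu; nia.
have vab : v (a@@u * b@@w) = v a@@u + v b@@w by exact: vM.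
have ab0 : a@@u * b@@w != 0 by rewrite mulf_neq0.
have sum_neq0 : (a * b)@@(u ++ w) != 0.
  rewrite cE addr_eq0; apply/negP => /eqP e; move: cle; rewrite -vle_opp -e /vle.
  by rewrite (negPf ab0) /=; lia.
split=> //; rewrite cE; rewrite cE in sum_neq0.
suff -> : v (a@@u * b@@w + c) = v (a@@u * b@@w) by rewrite vab size_cat; lia.
have [c0|c0] := eqVneq c 0; first by rewrite c0 addr0.
move: (cle); rewrite /vle (negPf c0) /= => vc.
have le1 : v (a@@u * b@@w + c) <= v (a@@u * b@@w) by apply: vD => //; lia.
(* [vD] bounds values from above only. If the value dropped, subtracting [c] again would bound
   [v (a@@u * b@@w)] below itself. *)
have [//|ge] : v (a@@u * b@@w + c) = v (a@@u * b@@w) \/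
  v (a@@u * b@@w + c) <= v (a@@u * b@@w) - 1 by lia.
suff : v (a@@u * b@@w) <= v (a@@u * b@@w) - 1 by lia.
rewrite -{1}(addrK c (a@@u * b@@w)); apply: vD; rewrite ?oppr_eq0 ?addrK ?vN //.
Qed.

Lemma reaches_wle g m m' w : wle g m -> reaches g m' w -> m' <= m.
Proof.
by move=> gm [gw <-]; have := gm w; rewrite /vle (negPf gw) /=; lia.
Qed.

End DegreeLike.

(** * Clearing denominators *)

Section Denominators.
Variable (E : idomainType).
Local Notation "x %:F" := (@tofrac E x).

Lemma tofrac_inj : injective (@tofrac E).
Proof. by move=> x y /eqP; rewrite tofrac_eq => /eqP. Qed.

Lemma fractionE (x : {fraction E}) : exists n d : E, d != 0 /\ x = n%:F / d%:F.
Proof.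
elim/quotW: x => x; exists \n_x, \d_x; split; first exact: denom_ratioP.
have d0 : (\d_x)%:F != 0 by rewrite tofrac_eq0 denom_ratioP.
apply: (mulIf d0); rewrite (divfK d0); unlock FracField.tofrac.
rewrite -[LHS]FracField.pi_mul; apply/eqmodP; rewrite /= FracField.equivfE.
rewrite /FracField.mulf !numden_Ratio ?mulf_neq0 ?oner_neq0 ?denom_ratioP //.
by rewrite !mulr1 mulrC.
Qed.

Lemma common_denominator (L : finType) (F : L -> {fraction E}) :
  exists (c : E) (z : L -> E), c != 0 /\ forall l, c%:F * F l = (z l)%:F.
Proof.
have /fin_all_exists[n /fin_all_exists[d nd]] l := fractionE (F l).
exists (\prod_l d l), (fun l => (\prod_(i | i != l) d i) * n l); split.
  by apply/prodf_neq0 => l _; case: (nd l).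
move=> l; have [dl ->] := nd l; rewrite (bigD1 l) //= !tofracM.
have d0 : (d l)%:F != 0 by rewrite tofrac_eq0.
by field.
Qed.

Lemma common_denominator_mx m n (Z : 'M[{fraction E}]_(m, n)) :
  exists (c : E) Z', c != 0 /\ c%:F *: Z = map_mx (@tofrac E) Z'.
Proof.
have [c [z [c0 cz]]] := common_denominator (fun ij => Z ij.1 ij.2).
exists c, (\matrix_(i, j) z (i, j)); split=> //.
by apply/matrixP => i j; rewrite !mxE (cz (i, j)).
Qed.

Lemma common_denominator_nc (I : choiceType) (g : freealg I {fraction E}) :
  exists (c : E) (g' : freealg I E), c != 0 /\ ncC c%:F * g = cmap (@tofrac E) g'.
Proof.
have [c [z [c0 cz]]] := common_denominator
  (fun i : 'I_(size (words g)) => g@@(nth [::] (words g) i)).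
exists c, (\sum_i ncmon (z i) (nth [::] (words g) i)); split=> //.
rewrite [g in LHS]ncmonE (big_nth [::]) big_mkord mulr_sumr rmorph_sum.
apply: eq_bigr => i _; apply/ncP => w.
by rewrite nccoefCM coef_cmap !coef_mon mulrnAr cz rmorphMn.
Qed.

End Denominators.

(** * Factorizations of a scalar matrix *)

Section ConstantCoefficient.
Variables (I : choiceType) (E : nzRingType).

Definition nceps (g : freealg I E) : E := g@@[::].

HB.instance Definition _ := GRing.Additive.copy nceps (nccoef (I := I) (E := E) [::]).

Fact nceps_is_multiplicative : multiplicative nceps.
Proof.
split=> [a b|]; last by rewrite /nceps nccoef1 eqxx.
by rewrite /nceps nccoefM big_ord1.
Qed.

HB.instance Definition _ :=
  GRing.isMultiplicative.Build (freealg I E) E nceps nceps_is_multiplicative.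

Lemma ncepsC c : nceps (ncC c) = c.
Proof. by rewrite /nceps nccoefC eqxx. Qed.

End ConstantCoefficient.

Section MatrixFactorization.
Variables (I : choiceType) (K : fieldType) (p : freealg I K).
Local Notation R := (freealg I K).
Hypothesis p_irr : forall x y : R, p = x * y ->
  (exists c, x = ncC c) \/ (exists c, y = ncC c).
Hypothesis eps_p : nceps p != 0.
Hypothesis eigenring_p : forall c c' : R, c * p = p * c' ->
  exists k z, c = ncC k + p * z.

Let p_neq0 : p != 0.
Proof. by apply: contraNneq eps_p => ->; rewrite rmorph0. Qed.

(* Taking constant coefficients gives a product of invertible scalar matrices. *)
Lemma full_row_unique N (A B : 'M[R]_N.+1) : A *m B = p%:M ->
    (forall y : 'cV_N.+1, row 0 A *m y = 0 -> forall j, A 0 j * y j 0 = 0) ->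
  exists j0, A 0 j0 != 0 /\ forall j, j != j0 -> A 0 j = 0.
Proof.
move=> AB ind.
have [j0 Aj0] : exists j0, A 0 j0 != 0.
  apply: NNPP => h; have : (A *m B) 0 0 = p by rewrite AB mxE eqxx mulr1n.
  rewrite mxE big1 => [/esym/eqP|j _]; first by rewrite (negPf p_neq0).
  suff /eqP -> : A 0 j == 0 by rewrite mul0r.
  by apply/negPn/negP => Aj; apply: h; exists j.
exists j0; split=> // j jj0; apply/eqP/negPn/negP => Aj.
have B0 i l : A 0 i != 0 -> l != 0 -> B i l = 0.
  move=> Ai l0; have e : row 0 A *m col l B = 0.
    apply/matrixP => a b; rewrite !ord1 mxE [RHS]mxE.
    have : (A *m B) 0 l = 0 by rewrite AB mxE eq_sym (negPf l0).
    by rewrite mxE => {2}<-; apply: eq_bigr => t _; rewrite !mxE.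
  have /eqP := ind _ e i; rewrite nc_mulf_eq0 (negPf Ai) /= mxE.
  by move/eqP.
pose X := (nceps p)^-1 *: map_mx (@nceps I K) A; pose Y := map_mx (@nceps I K) B.
have XY : Y *m X = 1%:M.
  apply: mulmx1C; rewrite -scalemxAl -map_mxM AB map_scalar_mx.
  by rewrite scale_scalar_mx mulVf.
(* Row [i] of [Y] is supported in column 0 as soon as [A 0 i] is nonzero. Two such rows would be
   proportional, against the invertibility of [Y]. *)
have YX i l : A 0 i != 0 -> Y i 0 * X 0 l = (i == l)%:R.
  move=> Ai; have := congr1 (fun Z : 'M_N.+1 => Z i l) XY.
  rewrite [in RHS]mxE => <-; rewrite [in RHS]mxE (bigD1 0) //= big1 ?addr0 // => t t0.
  by rewrite [Y i t]mxE B0 // rmorph0 mul0r.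
have := YX j j Aj; have := YX j0 j Aj0; rewrite eqxx eq_sym (negPf jj0).
move/eqP; rewrite mulf_eq0 => /orP[] /eqP e0.
  by have := YX j0 j0 Aj0; rewrite e0 mul0r eqxx => /esym/eqP; rewrite oner_eq0.
by rewrite e0 mulr0 => /esym/eqP; rewrite oner_eq0.
Qed.

(** The reduced first row has a single nonzero entry, which a transposition brings to the first
    column. *)
Lemma clear_first_row N (A B : 'M[R]_N.+1) : A *m B = p%:M ->
  exists P Q : 'M[R]_N.+1,
    [/\ P *m Q = 1%:M, Q *m P = 1%:M & forall j, j != 0 -> (A *m P) 0 j = 0].
Proof.
move=> AB; have [P [Q [PQ QP ind]]] := row_reduction (row 0 A).
have rowE j : (row 0 A *m P) 0 j = (A *m P) 0 j.
  by rewrite !mxE; apply: eq_bigr => i _; rewrite mxE.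
have [||j0 [Aj0 Aj]] := @full_row_unique N (A *m P) (Q *m B).
- by rewrite mulmxA -(mulmxA A) PQ mulmx1.
- by move=> y; rewrite row_mul => /ind h j; rewrite -rowE; apply: h.
have TT : tperm_mx 0 j0 *m tperm_mx 0 j0 = 1%:M :> 'M[R]_N.+1.
  by rewrite -perm_mxM tperm2 perm_mx1.
exists (P *m tperm_mx 0 j0), (tperm_mx 0 j0 *m Q); split.
- by rewrite mulmxA -(mulmxA P) TT mulmx1.
- by rewrite mulmxA -(mulmxA _ Q) QP mulmx1.
move=> j j_neq0; rewrite mulmxA -xcolE mxE; apply: Aj.
by rewrite (can2_eq (tpermK _ _) (tpermK _ _)) tpermR.
Qed.

(** Induction on the size with [A] made lower block triangular. The corner [a] divides [p] on the
    left, so [a] or its cofactor is constant. If the cofactor is, [p] divides the first column. If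
    [a] is, the column under it lies in the idealizer of [p], hence is constant modulo [p], and the
    multiples of [p] are cancelled through the lower block. *)
Lemma matrix_factorization N (A B : 'M[R]_N) : A *m B = p%:M ->
  (exists (k : 'cV[K]_N) y, k != 0 /\ A *m y = map_mx ncC k) \/
  (exists A', A = p%:M *m A').
Proof.
elim: N A B => [|N IHN] A B AB.
  by right; exists 0; apply/matrixP => -[].
have [P [Q [PQ QP row0]]] := clear_first_row AB.
have [A1 A1P] : exists X : 'M_(1 + N), X = A *m P by exists (A *m P).
have [B1 B1Q] : exists X : 'M_(1 + N), X = Q *m B by exists (Q *m B).
rewrite -A1P in row0.
have AE : A = A1 *m Q by rewrite A1P -mulmxA PQ mulmx1.
have A1B1 : A1 *m B1 = p%:M by rewrite B1Q mulmxA -AE.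
pose a := A1 0 0; pose b := B1 0 0.
have [q qE] : exists q, q = dlsubmx A1 by eexists.
have [A2 A2E] : exists X, X = drsubmx A1 by eexists.
have [s sE] : exists s, s = dlsubmx B1 by eexists.
have [B2 B2E] : exists X, X = drsubmx B1 by eexists.
have A1E : A1 = block_mx a%:M 0 q A2.
  rewrite -[LHS]submxK qE A2E; congr (block_mx _ _ _ _); apply/matrixP => i j.
    rewrite !ord1 !mxE eqxx mulr1n; congr (A1 _ _); exact/val_inj.
  rewrite !mxE ord1 -[RHS](row0 (rshift 1 j)) //; congr (A1 _ _); exact/val_inj.
have APcol (u : 'cV_1) (v : 'cV_N) :
    A *m (P *m (col_mx u v : 'cV_(1 + N))) = col_mx (a%:M *m u) (q *m u + A2 *m v).
  rewrite mulmxA -A1P; transitivity (A1 *m (col_mx u v : 'cV_(1 + N))) => //.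
  by rewrite A1E mul_block_col mul0mx addr0.
have mapE (u : 'cV[K]_1) (v : 'cV[K]_N) : map_mx ncC (col_mx u v : 'cV_(1 + N)) =
    col_mx (map_mx ncC u) (map_mx ncC v) :> 'cV[R]_(1 + N) by exact: map_col_mx.
have bE : ulsubmx B1 = b%:M.
  apply/matrixP => i j; rewrite !ord1 !mxE eqxx mulr1n; congr (B1 _ _); exact/val_inj.
have eqB := A1B1; rewrite A1E -[B1]submxK mulmx_block scalar_mx_block bE in eqB.
rewrite !mul0mx !addr0 -sE -B2E in eqB; case/eq_block_mx: eqB.
rewrite mul_scalar_mx scale_scalar_mx => abE aur dl dr.
have {abE} ab : a * b = p.
  by have := congr1 (fun Z : 'M_1 => Z 0 0) abE; rewrite !mxE eqxx !mulr1n.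
have a0 : a != 0 by apply: contraNneq p_neq0 => a0; rewrite -ab a0 mul0r.
have ur0 : ursubmx B1 = 0.
  apply/matrixP => i j; have := congr1 (fun Z : 'M[R]_(1, N) => Z i j) aur.
  rewrite mul_scalar_mx !mxE => /eqP; rewrite nc_mulf_eq0 (negPf a0) /=.
  by move/eqP.
move: dr; rewrite ur0 mulmx0 add0r => A2B2.
have [[k [y [k0 Ay]]]|[A2' A2D]] := IHN _ _ A2B2.
  left; exists (col_mx (0 : 'cV[K]_1) k), (P *m col_mx (0 : 'cV[R]_1) y); split.
    apply: contraNneq k0 => h; apply/eqP/colP => i.
    by have := congr1 (fun Z : 'cV_(1 + N) => Z (rshift 1 i) 0) h; rewrite col_mxEd !mxE.
  rewrite APcol !mulmx0 add0r Ay.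
  by apply: etrans (esym (mapE 0 k)); rewrite raddf0.
move/eqP: dl; rewrite addr_eq0 => /eqP dl.
have [[c aE]|[c bc]] := p_irr (esym ab).
  left; have c0 : c != 0 by apply: contraNneq a0 => c0; rewrite aE c0 raddf0.
  have bp : b = ncC c^-1 * p.
    by rewrite -ab aE mulrA -rmorphM mulVf // rmorph1 mul1r.
  have /fin_all_exists[k /fin_all_exists[z kz]] : forall i : 'I_N, exists k z,
       q i 0 * ncC c^-1 = ncC k + p * z.
    move=> i; apply: (eigenring_p (c' := - (A2' *m s) i 0)).
    have := congr1 (fun Z : 'cV_N => Z i 0) dl.
    by rewrite A2D -mulmxA mul_scalar_mx -scalerN !mxE big_ord1 mxE eqxx mulr1n bp mulrA => ->.
  (* As [A2 *m B2] is the scalar [p], this choice removes the part [p * z i] and leaves the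
     constants [k i]. *)
  pose y2 := - (B2 *m (\col_i z i)).
  exists (col_mx (1%:M : 'cV[K]_1) (\col_i k i)),
    (P *m col_mx ((ncC c^-1)%:M : 'cV[R]_1) y2); split.
    apply/eqP => h; have := congr1 (fun Z : 'cV_(1 + N) => Z (lshift N 0) 0) h.
    by rewrite col_mxEu !mxE eqxx => /eqP; rewrite oner_eq0.
  rewrite APcol; apply: etrans (esym (mapE _ _)); congr col_mx.
    rewrite mul_scalar_mx scale_scalar_mx aE -rmorphM divff //.
    by rewrite map_scalar_mx.
  rewrite /y2 mulmxN mulmxA A2B2 mul_scalar_mx; apply/matrixP => i j.
  rewrite ord1 !mxE big_ord1 !mxE eqxx mulr1n kz addrK.
  by [].
have c0 : c != 0.
  by apply: contraNneq p_neq0 => c0; rewrite -ab bc c0 raddf0 mulr0.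
have ap : a = p * ncC c^-1 by rewrite -ab bc -mulrA -rmorphM divff // rmorph1 mulr1.
pose Z : 'M[R]_(1 + N) :=
  block_mx (ncC c^-1)%:M 0 (- (A2' *m s) *m (ncC c^-1)%:M) A2'.
have A1Z : A1 = p%:M *m Z.
  rewrite A1E scalar_mx_block mulmx_block !mul0mx !mulmx0 !addr0 !add0r -A2D.
  rewrite mul_scalar_mx scale_scalar_mx -ap mulmxA mulmxN mulmxA -A2D -dl bc.
  by rewrite -mulmxA mul_scalar_mx scale_scalar_mx -rmorphM divff // rmorph1 mulmx1.
by right; exists (Z *m Q); rewrite AE A1Z; exact: esym (mulmxA p%:M Z Q).
Qed.

End MatrixFactorization.

(** * The generic fibre of a family of factorizations *)

Section GenericFibre.
Variables (k : fieldType) (J : Type) (lam : J -> k) (Q : nat) (e : J -> 'cV[k]_Q).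
Hypothesis lam_inf : forall s : seq k, exists j, lam j \notin s.
Local Notation K := {fraction {poly k}}.
Local Notation ev j := (map_mx (horner_eval (lam j))).
Local Notation "x %:F" := (@tofrac {poly k} x).
Local Notation frac := (map_mx (@tofrac {poly k})).

Lemma poly_neq0_at (P : {poly k}) : P != 0 -> exists j, P.[lam j] != 0.
Proof.
move=> P0; have [s sP] : exists s : seq k, forall x, root P x -> x \in s.
  elim: {P}(size P) {-2}P (leqnn (size P)) P0 => [|n IHn] P.
    by rewrite leqn0 size_poly_eq0 => ->.
  move=> sP P0; case: (classic (exists x, root P x)) => [[x Px]|noroot]; last first.
    by exists [::] => x Px; case: noroot; exists x.
  have /factor_theorem[P' PE] := Px.
  have P'0 : P' != 0 by apply: contraNneq P0 => P'0; rewrite PE P'0 mul0r.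
  have [|s sP'] := IHn P' _ P'0.
    by move: sP; rewrite PE size_Mmonic ?monicXsubC // size_XsubC addn2.
  exists (x :: s) => y; rewrite PE rootM root_XsubC in_cons.
  by case/orP => [/sP' ->|->]; rewrite ?orbT.
by have [j jP] := lam_inf s; exists j; apply: contra jP => /sP.
Qed.

Definition annihilates m (Y : 'M[{poly k}]_(m, Q)) := forall j, ev j Y *m e j = 0.

Definition multiplier (phi : J -> k) (X : 'M[{poly k}]_Q) :=
  forall j, ev j X *m e j = phi j *: e j.

(** Ranks over K are at most [Q], so adjoining relations that enlarge the row space must stop. *)
Lemma maximal_annihilator : exists m (Y : 'M[{poly k}]_(m, Q)), annihilates Y /\
  forall y : 'rV_Q, annihilates y -> (frac y <= frac Y)%MS.
Proof.
suff gen n : forall m (Y : 'M_(m, Q)), annihilates Y -> (Q - \rank (frac Y) < n)%N ->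
    exists m (Y : 'M[{poly k}]_(m, Q)), annihilates Y /\
    forall y : 'rV_Q, annihilates y -> (frac y <= frac Y)%MS.
  by apply: (gen Q.+1 0%N 0) => [j|]; rewrite ?ltnS ?leq_subr //; apply/matrixP => -[].
elim: n => // n IHn m Y annY Yn.
case: (classic (forall y : 'rV_Q, annihilates y -> (frac y <= frac Y)%MS)) => [maxY|].
  by exists m, Y.
case/not_all_ex_not => y noty; have [anny /negP yY] := imply_to_and _ _ noty.
apply: (IHn (m + 1)%N (col_mx Y y)) => [j|].
  by rewrite map_col_mx mul_col_mx annY anny col_mx0.
have lt : (\rank (frac Y) < \rank (frac (col_mx Y y)))%N.
  rewrite map_col_mx -addsmxE; apply: rank_ltmx.
  by rewrite ltmxE addsmxSl /= addsmx_sub submx_refl.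
have := rank_leq_col (frac (col_mx Y y)); lia.
Qed.

(* C and C' describe the quotient of K^Q dual to the relations Y that hold at
   all e j; the polynomial matrices multiplying the e j by a scalar act on it. *)
Lemma generic_fibre i mu : mu != 0 -> (forall j, e j i 0 = mu) ->
  exists N (C : 'M[K]_(Q, N.+1)) (C' : 'M[K]_(N.+1, Q)), C' *m C = 1%:M /\
    (forall m (Y : 'M_(m, Q)), annihilates Y -> frac Y *m C = 0) /\
    (forall phi X, multiplier phi X -> frac X *m C = C *m (C' *m frac X *m C)).
Proof.
move=> mu0 ei; have [m [Y [annY maxY]]] := maximal_annihilator.
have subY (y : 'rV[K]_Q) : (y <= frac Y)%MS ->
    exists c (y' : 'rV_Q), [/\ c != 0, c%:F *: y = frac y' & annihilates y'].
  case/submxP => z ->; have [c [z' [c0 cz]]] := common_denominator_mx z.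
  exists c, (z' *m Y); split=> //; first by rewrite map_mxM -cz scalemxAl.
  by move=> j; rewrite map_mxM -mulmxA annY mulmx0.
have annC m' (Y' : 'M_(m', Q)) : annihilates Y' -> (frac Y' <= frac Y)%MS.
  move=> annY'; apply/row_subP => l; rewrite -map_row; apply: maxY => j.
  by rewrite map_row -row_mul annY' row0.
pose D := cokermx (frac Y).
(* At full rank, a multiple [c] of the i-th coordinate form would annihilate every [e j]; but
   [c.[lam j] * mu] is nonzero for some [j]. *)
have rkD : (0 < \rank D)%N.
  rewrite mxrank_coker subn_gt0 ltnNge; apply/negP => full.
  have [|c [y [c0 cy anny]]] := subY (delta_mx 0 i).
    by apply: submx_full; rewrite /row_full eqn_leq rank_leq_col.
  have [j cj] := poly_neq0_at c0.
  have yE : y = c *: delta_mx 0 i.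
    apply/matrixP => a b; apply: tofrac_inj.
    have := congr1 (fun Z : 'rV_Q => Z a b) cy; rewrite !mxE tofracM => <-.
    by congr (_ * _); rewrite rmorph_nat.
  have := congr1 (fun Z : 'M_1 => Z 0 0) (anny j); rewrite yE !mxE (bigD1 i) //=.
  rewrite big1 => [|l li].
    rewrite !mxE !eqxx mulr1 addr0 /horner_eval => /eqP.
    by rewrite ei mulf_eq0 (negPf cj) (negPf mu0).
  by rewrite !mxE (negPf li) andbF mulr0 /horner_eval horner0 mul0r.
have [N NE] : exists N, \rank D = N.+1 by exists (\rank D).-1; rewrite prednK.
have [C [C' [CC CY]]] : exists (C : 'M[K]_(Q, N.+1)) (C' : 'M[K]_(N.+1, Q)),
    C' *m C = 1%:M /\ forall m' (z : 'M[K]_(m', Q)), (z <= frac Y)%MS = (z *m C == 0).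
  have : exists (C : 'M[K]_(Q, \rank D)) (C' : 'M[K]_(\rank D, Q)),
    C' *m C = 1%:M /\ forall m' (z : 'M[K]_(m', Q)), (z <= frac Y)%MS = (z *m C == 0).
    exists (col_base D), (pinvmx (col_base D)); split.
      by apply: mulVpmx; apply: col_base_full.
    move=> m' z; rewrite submxE -/D -{1}(mulmx_base D) mulmxA.
    by rewrite (mulmx_free_eq0 _ (row_base_free D)).
  by rewrite NE.
exists N, C, C'; split=> //; split=> [m' Y' /annC|phi X XE].
  by rewrite CY => /eqP.
rewrite -[C' *m _ *m _]mulmxA mulmxA -[LHS]mul1mx; apply/eqP; rewrite -subr_eq0 -mulmxBl mulmxA -CY.
(* The rows of [1 - C *m C'] are relations, and a relation followed by a multiplier is again a
   relation, hence killed by [C]. *)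
have : (1%:M - C *m C' <= frac Y)%MS.
  by rewrite CY mulmxBl mul1mx -mulmxA CC mulmx1 subrr.
case/submxP => Z ->; rewrite -mulmxA -map_mxM; apply: submx_trans (submxMl _ _) _.
apply: annC => j; rewrite map_mxM -mulmxA XE -scalemxAr annY.
by rewrite scaler0.
Qed.

End GenericFibre.

Definition words_upto (I : finType) n : seq (seq I) :=
  flatten [seq [seq val t | t <- enum {: m.-tuple I}] | m <- iota 0 n.+1].

Lemma mem_words_upto (I : finType) n (w : seq I) : (size w <= n)%N -> w \in words_upto I n.
Proof.
move=> wn; apply/flatten_mapP; exists (size w); first by rewrite mem_iota ltnS.
by apply/mapP; exists (in_tuple w); rewrite ?mem_enum.
Qed.

Lemma coef_sum_words (I : choiceType) (E : nzRingType) (S : seq (seq I)) (g : seq I -> E) w :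
  (w \notin S -> g w = 0) -> (\sum_(u <- undup S) ncmon (g u) u)@@w = g w.
Proof.
move=> gS; rewrite nccoef_sum; case: (boolP (w \in S)) => wS.
  rewrite (bigD1_seq w) ?mem_undup ?undup_uniq //= coef_mon eqxx mulr1n.
  by rewrite big1 ?addr0 // => u uw; rewrite coef_mon (negPf uw).
rewrite gS // big_seq big1 // => u; rewrite mem_undup coef_mon => uS.
by case: eqP => // uw; rewrite -uw uS in wS.
Qed.

Section FactorFamily.
Variables (I : finType) (k : fieldType) (f : freealg I k).
Variables (J : Type) (lam : J -> k) (a b : J -> freealg I k) (u0 v0 : seq I).
Hypothesis lam_inf : forall s : seq k, exists j, lam j \notin s.
Hypothesis abE : forall j, f - ncC (lam j) = a j * b j.
Hypothesis u0_gt0 : (0 < size u0)%N.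
Hypothesis a_size : forall j, (nsize (a j) <= (size u0).+1)%N.
Hypothesis b_size : forall j, (nsize (b j) <= (size v0).+1)%N.
Hypothesis b_top : forall j, (b j)@@v0 = 1.
Hypothesis f_top : f@@(u0 ++ v0) != 0.
Local Notation K := {fraction {poly k}}.
Local Notation frac := (map_mx (@tofrac {poly k})).
Local Notation "x %:F" := (@tofrac {poly k} x).
Local Notation ev j := (horner_eval (lam j)).

Definition shifted_coef w : {poly k} := (f@@w)%:P - 'X *+ (w == [::]).

Lemma ev_shifted_coef j w : ev j (shifted_coef w) = (a j * b j)@@w.
Proof.
rewrite -abE nccoefB nccoefC /shifted_coef /horner_eval.
by rewrite hornerD hornerN hornerMn hornerC hornerX.
Qed.

(** Normalizing [b j] at [v0] makes the coefficients of [a j] at all words of top length independent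
    of [j]; this is what later makes the top coefficients of [A] scalar matrices. *)
Lemma a_top j w : size w = size u0 -> (a j)@@w = f@@(w ++ v0).
Proof.
move=> sw; have := coefM_top (a := a j) (b := b j) (u := w) (v := v0).
rewrite sw b_top mulr1 => <- //; rewrite -abE nccoefB nccoefC.
case: w sw => [sw|x w _]; first by move: u0_gt0; rewrite -sw.
by rewrite mulr0n subr0.
Qed.

Local Notation S := (words_upto I (size u0 + size v0)).
Local Notation q := (size S).-1.
Local Notation T := (q.-tuple 'I_(size S)).

(* By Dedekind-Mertens, multiplication by a coefficient of a j acts on the
   products of q coefficients of a j through polynomials in lam j. *)
Definition coef_monomial (t : T) j := \prod_(i <- t) (a j)@@(nth [::] S i).

Definition monomial_vector j : 'cV[k]_#|{: T}| := \col_i coef_monomial (enum_val i) j.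

Local Notation e := monomial_vector.

Lemma size_words_gt0 : (0 < size S)%N.
Proof.
have := mem_words_upto (leq0n (size u0 + size v0)) (w := [::] : seq I).
by case: S.
Qed.

Lemma a_supported : supported S a.
Proof.
move=> j w wS; apply: coef_nsize; apply: leq_trans (a_size j) _.
rewrite ltnNge; apply: contra wS => wu; apply: mem_words_upto.
exact: leq_trans wu (leq_addr _ _).
Qed.

Lemma b_supported : supported S b.
Proof.
move=> j w wS; apply: coef_nsize; apply: leq_trans (b_size j) _.
rewrite ltnNge; apply: contra wS => wu; apply: mem_words_upto.
exact: leq_trans wu (leq_addl _ _).
Qed.

Let in_span (x : J -> k) :=
  exists y : 'rV[{poly k}]_#|{: T}|, forall j, x j = (map_mx (ev j) y *m e j) 0 0.

(** Dedekind-Mertens is read at [v0], where [b j] has coefficient 1, so the factor from [b j]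
    disappears. The coefficients of [a j * b j] are values of polynomials at [lam j]. *)
Lemma in_span_coefprod s : size s = q.+1 -> in_span (coefprod a s).
Proof.
move=> ss.
have span0 : in_span (fun=> 0).
  by exists 0 => j; rewrite map_mx0 mul0mx mxE.
have spanB x y z : in_span x -> in_span y -> (forall j, z j = x j - y j) -> in_span z.
  case=> [X XE] [Y YE] zE; exists (X - Y) => j.
  by rewrite zE XE YE map_mxB mulmxBl !mxE.
have span_top w s' : size s' = q ->
    in_span (fun j => coefprod a s' j * (a j * b j)@@w).
  move=> ss'; case: (boolP (all (mem S) s')) => [s'S|/allPn[u us' uS]]; last first.
    apply: (spanB _ _ _ span0 span0) => j; rewrite subrr /coefprod.
    by rewrite (perm_big _ (perm_to_rem us')) big_cons /= a_supported ?mul0r.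
  have [t tE] : exists t : T, s' = [seq nth [::] S i | i : 'I_(size S) <- t].
    have [r rE] : exists r : seq 'I_(size S), s' = [seq nth [::] S i | i : 'I_(size S) <- r].
      elim: (s') s'S => [|u r IHr]; first by exists [::].
      rewrite /= -index_mem => /andP[uS /IHr[r' ->]]; exists (Ordinal uS :: r').
      by rewrite /= nth_index // -index_mem.
    have rq : size r == q by rewrite -ss' rE size_map.
    by exists (Tuple rq).
  have {}tE j : coef_monomial t j = coefprod a s' j by rewrite tE /coefprod big_map.
  exists (shifted_coef w *: delta_mx 0 (enum_rank t)) => j.
  rewrite mxE (bigD1 (enum_rank t)) //= big1 => [|l lt].
    rewrite !mxE !eqxx mulr1 addr0 enum_rankK tE -ev_shifted_coef.
    by rewrite mulrC.
  by rewrite !mxE (negPf lt) andbF mulr0 rmorph0 mul0r.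
have sS : (size S <= q.+1)%N by rewrite prednK // size_words_gt0.
case: (dedekind_mertens spanB a_supported b_supported sS span_top v0 ss) => Y YE.
by exists Y => j; rewrite -YE b_top mulr1.
Qed.

Let multipliable (phi : J -> k) := exists X, multiplier lam e phi X.

Let multipliable_eq x y : multipliable x -> (forall j, x j = y j) -> multipliable y.
Proof. by case=> X XE xy; exists X => j; rewrite -xy XE. Qed.

Let multipliable0 : multipliable (fun=> 0).
Proof. by exists 0 => j; rewrite map_mx0 mul0mx scale0r. Qed.

Let multipliableB x y :
  multipliable x -> multipliable y -> multipliable (fun j => x j - y j).
Proof.
case=> X XE [Y YE]; exists (X - Y) => j.
by rewrite map_mxB mulmxBl XE YE scalerBl.
Qed.

Let multipliableM x y :
  multipliable x -> multipliable y -> multipliable (fun j => x j * y j).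
Proof.
case=> X XE [Y YE]; exists (X *m Y) => j.
by rewrite map_mxM -mulmxA YE -scalemxAr XE scalerA mulrC.
Qed.

Let multipliableP (P : {poly k}) : multipliable (fun j => P.[lam j]).
Proof. by exists P%:M => j; rewrite map_scalar_mx mul_scalar_mx. Qed.

Let multipliable_a u : multipliable (fun j => (a j)@@u).
Proof.
have /fin_all_exists[r rE] (i : 'I_#|{: T}|) : exists y : 'rV[{poly k}]_#|{: T}|,
    forall j, (a j)@@u * e j i 0 = (map_mx (ev j) y *m e j) 0 0.
  pose t : T := enum_val i.
  have [|y yE] := @in_span_coefprod (u :: [seq nth [::] S i | i : 'I_(size S) <- t]).
    by rewrite /= size_map size_tuple.
  by exists y => j; rewrite -yE /coefprod big_cons big_map mxE.
exists (\matrix_i r i) => j; apply/colP => i; rewrite [RHS]mxE rE !mxE.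
by apply: eq_bigr => l _; rewrite !mxE.
Qed.

(** The coefficient of [a j] at [u0] is a nonzero constant of [f], so those of [b j] follow by
    division inside the ring of multipliable functions. *)
Let multipliable_b v : multipliable (fun j => (b j)@@v).
Proof.
pose mu := f@@(u0 ++ v0).
apply: (@top_division_closed _ _ _ multipliable a b u0 mu^-1 _ _ _ _ _ _ _ _ _ (size v0).+1) => //.
- by apply: multipliable_eq (multipliableP (mu^-1)%:P) _ => j; rewrite hornerC.
- by move=> j; rewrite a_top // mulVf.
- by move=> w; apply: multipliable_eq (multipliableP (shifted_coef w)) _ => j;
  apply: ev_shifted_coef.
Qed.

Definition generic_shift : freealg I K :=
  cmap (@tofrac {poly k} \o polyC) f - ncC ('X)%:F.

Lemma coef_generic_shift w : generic_shift@@w = (shifted_coef w)%:F.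
Proof.
rewrite nccoefB coef_cmap nccoefC /shifted_coef tofracB tofracMn.
by [].
Qed.

(** The coefficients of [a j] and [b j] act on the quotient space through the matrices [Xc] and
    [Yc], which become the coefficients of [A] and [B]. Functions polynomial in [lam j] act as
    scalars, so [A *m B] and the top of [A] are scalar. *)
Lemma generic_factorization : exists N (A B : 'M[freealg I K]_N.+1),
  [/\ A *m B = generic_shift%:M,
      forall i l, (nsize (A i l) <= (size u0).+1)%N &
      forall i l w, size w = size u0 ->
        (A i l)@@w = (f@@(w ++ v0))%:P%:F *+ (i == l)].
Proof.
have S0 := size_words_gt0.
have u0S : u0 \in S by apply: mem_words_upto; apply: leq_addr.
have iu0 : (index u0 S < size S)%N by rewrite index_mem.
(* The monomial made of the coefficient at [u0] alone is the nonzero constant coordinate required by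
   [generic_fibre]. *)
pose t0 : T := [tuple Ordinal iu0 | _ < q].
have [||N [C [C' [CC [annC repC]]]]] :=
  @generic_fibre k J lam _ e lam_inf (enum_rank t0) (f@@(u0 ++ v0) ^+ q).
- by rewrite expf_neq0.
- move=> j; rewrite mxE enum_rankK /coef_monomial.
  rewrite (eq_big_seq (fun=> f@@(u0 ++ v0))) => [|i]; last first.
    by case/mapP => l _ ->; rewrite /= nth_index // a_top.
  by rewrite big_const_seq count_predT size_tuple iter_mulr_1.
have scalarC (P : {poly k}) (Z : 'M_#|{: T}|) :
    (forall j, map_mx (ev j) Z *m e j = P.[lam j] *: e j) ->
    C' *m frac Z *m C = (P%:F)%:M.
  move=> ZE; have annZ : annihilates lam e (Z - P%:M).
    by move=> j; rewrite map_mxB mulmxBl ZE map_scalar_mx mul_scalar_mx subrr.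
  have := annC _ _ annZ; rewrite map_mxB mulmxBl => /subr0_eq ZC.
  by rewrite -mulmxA ZC map_scalar_mx mul_scalar_mx -scalemxAr CC scalemx1.
(* Taking the zero matrix beyond the degree bound makes the chosen multipliers the coefficients of a
   polynomial matrix. *)
have trunc n (x : J -> seq I -> k) : (forall u, multipliable (x^~ u)) ->
    (forall j u, (n < size u)%N -> x j u = 0) ->
    exists X, forall u, multiplier lam e (x^~ u) (X u) /\ ((n < size u)%N -> X u = 0).
  move=> mx xn; apply: (ClassicalEpsilon.choice
    (fun u X => multiplier lam e (x^~ u) X /\ ((n < size u)%N -> X = 0))) => u.
  case: (ltnP n (size u)) => [nu|un].
    by exists 0; split=> // j; rewrite map_mx0 mul0mx xn // scale0r.
  by have [X XE] := mx u; exists X; split.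
have [|X XE] := trunc (size u0) (fun j u => (a j)@@u) multipliable_a.
  by move=> j u uu; apply: coef_nsize; apply: leq_trans uu.
have [|Y YE] := trunc (size v0) (fun j v => (b j)@@v) multipliable_b.
  by move=> j u uu; apply: coef_nsize; apply: leq_trans uu.
pose Xc u := C' *m frac (X u) *m C; pose Yc u := C' *m frac (Y u) *m C.
have Xc0 u : u \notin S -> Xc u = 0.
  move=> uS; have [_ X0] := XE u; rewrite /Xc X0 ?map_mx0 ?mulmx0 ?mul0mx //.
  rewrite ltnNge; apply: contra uS => uu; apply: mem_words_upto.
  exact: leq_trans uu (leq_addr _ _).
have Yc0 u : u \notin S -> Yc u = 0.
  move=> uS; have [_ Y0] := YE u; rewrite /Yc Y0 ?map_mx0 ?mulmx0 ?mul0mx //.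
  rewrite ltnNge; apply: contra uS => uu; apply: mem_words_upto.
  exact: leq_trans uu (leq_addl _ _).
pose mx (Z : seq I -> 'M[K]_N.+1) : 'M[freealg I K]_N.+1 :=
  \matrix_(i, l) \sum_(u <- undup S) ncmon (Z u i l) u.
have mxE' Z i l w : (forall u, u \notin S -> Z u = 0) -> (mx Z i l)@@w = Z w i l.
  by move=> Z0; rewrite mxE coef_sum_words // => /Z0 ->; rewrite mxE.
exists N, (mx Xc), (mx Yc); split.
- apply/matrixP => i l; apply/ncP => w.
  have sumXY : \sum_(i < (size w).+1) Xc (take i w) *m Yc (drop i w) =
      ((shifted_coef w)%:F)%:M.
    have XY u v : Xc u *m Yc v = C' *m frac (X u *m Y v) *m C.
      have XC : frac (X u) *m C = C *m Xc u by have [/repC] := XE u.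
      have YC : frac (Y v) *m C = C *m Yc v by have [/repC] := YE v.
      rewrite map_mxM -mulmxA -(mulmxA (frac _)) YC (mulmxA (frac _)) XC.
      by rewrite -(mulmxA C) mulmxA CC mul1mx.
    under eq_bigr => l' _ do rewrite XY.
    rewrite -mulmx_suml -mulmx_sumr -raddf_sum; apply: scalarC => j.
    have -> : (shifted_coef w).[lam j] = (a j * b j)@@w by exact: ev_shifted_coef.
    rewrite raddf_sum mulmx_suml nccoefM scaler_suml; apply: eq_bigr => l' _ /=.
    have [Xu _] := XE (take l' w); have [Yv _] := YE (drop l' w).
    by rewrite map_mxM -mulmxA Yv -scalemxAr Xu scalerA mulrC.
  have sumE : \sum_(t < (size w).+1) (Xc (take t w) *m Yc (drop t w)) i l =
      (shifted_coef w)%:F *+ (i == l) by rewrite -summxE sumXY mxE.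
  rewrite [X in _ = X@@w]mxE raddfMn /= coef_generic_shift -sumE.
  rewrite mxE nccoef_sum; under [RHS]eq_bigr => l' _ do rewrite mxE.
  rewrite exchange_big /=; apply: eq_bigr => t _; rewrite nccoefM.
  by apply: eq_bigr => l' _; rewrite !mxE'.
- move=> i l; apply/nsizeP => w uw; rewrite mxE' //.
  by have [_ X0] := XE w; rewrite /Xc X0 // map_mx0 mulmx0 mul0mx mxE.
move=> i l w wu; rewrite mxE' // /Xc (scalarC (f@@(w ++ v0))%:P) ?mxE // => j.
by have [Xw _] := XE w; rewrite Xw /= a_top // hornerC.
Qed.

End FactorFamily.

(** * Left substitution and eigenrings *)

Section LeftSubstitution.
Variables (I : choiceType) (k E : comNzRingType).
Variables (iota : {rmorphism k -> E}) (theta : {rmorphism E -> freealg I k}).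
Hypothesis theta_iota : forall c, theta (iota c) = ncC c.
Implicit Types (z y : freealg I E) (a : freealg I k) (c : E).

(* Left substitution of theta c for the scalar c. *)
Definition lsub z : freealg I k := \sum_(w <- words z) theta z@@w * ncmon 1 w.

Lemma lsubE (S : seq (seq I)) z : uniq S -> (forall w, w \notin S -> z@@w = 0) ->
  lsub z = \sum_(w <- S) theta z@@w * ncmon 1 w.
Proof.
move=> uS zS; rewrite /lsub [RHS](bigID (mem (words z))) /= [X in _ + X]big1 ?addr0.
  rewrite -[RHS]big_filter; apply: perm_big; apply: uniq_perm.
  - exact: words_uniq.
  - exact: filter_uniq.
  move=> w; rewrite mem_filter; case: (boolP (w \in words z)) => //= wz.
  by apply/esym; apply: contraLR wz => /zS zw; rewrite mem_words zw eqxx.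
by move=> w; rewrite mem_words negbK => /eqP ->; rewrite rmorph0 mul0r.
Qed.

Fact lsub_is_additive : additive lsub.
Proof.
move=> z y; set S := undup (words z ++ words y).
have SE g : (forall w, g@@w != 0 -> (w \in words z) || (w \in words y)) ->
    lsub g = \sum_(w <- S) theta g@@w * ncmon 1 w.
  move=> gS; apply: lsubE; rewrite ?undup_uniq // => w; rewrite mem_undup mem_cat.
  by apply: contraNeq => /gS.
rewrite !SE => [|w|w|w].
- by rewrite -sumrB; apply: eq_bigr => w _; rewrite nccoefB rmorphB mulrBl.
- by rewrite !mem_words => ->; rewrite orbT.
- by rewrite !mem_words => ->.
rewrite !mem_words; apply: contraR; rewrite negb_or !negbK => /andP[/eqP zw /eqP yw].
by rewrite nccoefB zw yw subrr.
Qed.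

HB.instance Definition _ :=
  GRing.isAdditive.Build (freealg I E) (freealg I k) lsub lsub_is_additive.

Lemma lsub_mon c w : lsub (ncmon c w) = theta c * ncmon 1 w.
Proof.
rewrite (lsubE (S := [:: w])) // => [|v].
  by rewrite big_seq1 coef_mon eqxx mulr1n.
by rewrite mem_seq1 coef_mon eq_sym => /negPf ->.
Qed.

Lemma ncmonE1 (R : nzRingType) (c : R) (w : seq I) : ncmon c w = ncC c * ncmon 1 w.
Proof. by apply/ncP => v; rewrite nccoefCM !coef_mon mulrnAr mulr1. Qed.

Lemma lsubCM c z : lsub (ncC c * z) = theta c * lsub z.
Proof.
rewrite [z in LHS]ncmonE [z in RHS]ncmonE mulr_sumr !raddf_sum mulr_sumr /=.
apply: eq_bigr => w _; have -> : ncC c * ncmon z@@w w = ncmon (c * z@@w) w.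
  by apply/ncP => v; rewrite nccoefCM !coef_mon mulrnAr.
by rewrite !lsub_mon rmorphM mulrA.
Qed.

Lemma lsub_cmap a : lsub (cmap iota a) = a.
Proof.
rewrite [RHS]ncmonE [a in LHS]ncmonE (raddf_sum (cmap iota)) (raddf_sum lsub) /=.
apply: eq_bigr => w _; have -> : cmap iota (ncmon a@@w w) = ncmon (iota a@@w) w.
  by apply/ncP => v; rewrite coef_cmap !coef_mon rmorphMn.
by rewrite lsub_mon theta_iota -ncmonE1.
Qed.

(** Scalars are central before the substitution, so [z] may be taken to be a word; then [theta c]
    and the scalar [c] in front of it have the same image. The substitution thus kills a right
    ideal, though it is not multiplicative in general. *)
Lemma lsub_kill c z : lsub ((cmap iota (theta c) - ncC c) * z) = 0.
Proof.
rewrite [z]ncmonE mulr_sumr raddf_sum big1 //= => w _; rewrite ncmonE1 mulrA.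
have ncCC e y : y * ncC e = ncC e * y :> freealg I E.
  by apply/ncP => v; rewrite nccoefCM nccoefMC mulrC.
rewrite ncCC -mulrA lsubCM mulrBl raddfB /= -ncmonE1 lsub_mon.
have -> : ncmon 1 w = cmap iota (ncmon 1 w) :> freealg I E.
  by apply/ncP => v; rewrite coef_cmap !coef_mon rmorphMn rmorph1.
by rewrite -rmorphM lsub_cmap subrr mulr0.
Qed.

End LeftSubstitution.

Lemma ncCM (I : choiceType) (E : nzRingType) (c e : E) :
  ncC (c * e) = ncC c * ncC e :> freealg I E.
Proof. exact: rmorphM. Qed.

Lemma cmapM (I : choiceType) (E E' : nzRingType) (phi : {rmorphism E -> E'})
  (x y : freealg I E) : cmap phi (x * y) = cmap phi x * cmap phi y.
Proof. exact: rmorphM. Qed.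

Lemma cmapD (I : choiceType) (E E' : nzRingType) (phi : {rmorphism E -> E'})
  (x y : freealg I E) : cmap phi (x + y) = cmap phi x + cmap phi y.
Proof. exact: raddfD. Qed.

Lemma cmapB (I : choiceType) (E E' : nzRingType) (phi : {rmorphism E -> E'})
  (x y : freealg I E) : cmap phi (x - y) = cmap phi x - cmap phi y.
Proof. exact: raddfB. Qed.

Section PolynomialValues.
Variables (I : choiceType) (k : comNzRingType) (h : freealg I k).

Definition nceval (P : {poly k}) : freealg I k := (map_poly ncC P).[h].

Fact nceval_is_additive : additive nceval.
Proof. by move=> P P'; rewrite /nceval rmorphB hornerD hornerN. Qed.

HB.instance Definition _ :=
  GRing.isAdditive.Build {poly k} (freealg I k) nceval nceval_is_additive.

Lemma ncC_comm c (g : freealg I k) : g * ncC c = ncC c * g.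
Proof. by apply/ncP => w; rewrite nccoefCM nccoefMC mulrC. Qed.

Lemma nceval_comm P (g : freealg I k) : g * h = h * g -> g * nceval P = nceval P * g.
Proof.
move=> gh; rewrite /nceval; elim/poly_ind: P => [|P c IHP].
  by rewrite rmorph0 horner0 mulr0 mul0r.
rewrite rmorphD rmorphM /= map_polyX map_polyC /= hornerMXaddC.
by rewrite mulrDr mulrDl ncC_comm mulrA IHP -!mulrA gh.
Qed.

Lemma ncevalD P P' : nceval (P + P') = nceval P + nceval P'.
Proof. exact: raddfD. Qed.

Lemma ncevalMX P : nceval (P * 'X) = nceval P * h.
Proof. by rewrite /nceval rmorphM /= map_polyX hornerMX. Qed.

Fact nceval_is_multiplicative : multiplicative nceval.
Proof.
split=> [P P'|]; last by rewrite /nceval rmorph1 hornerC.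
elim/poly_ind: P => [|P c IHP]; first by rewrite mul0r !raddf0 mul0r.
rewrite mulrDl -mulrA ['X * _]mulrC mulrA !raddfD /= mulrDl; congr (_ + _).
  by rewrite !ncevalMX IHP -!mulrA; congr (_ * _); apply/esym/nceval_comm.
by rewrite mul_polyC /nceval map_polyZ /= -mul_polyC hornerCM map_polyC hornerC.
Qed.

HB.instance Definition _ :=
  GRing.isMultiplicative.Build {poly k} (freealg I k) nceval nceval_is_multiplicative.

Lemma ncevalC c : nceval c%:P = ncC c.
Proof. by rewrite /nceval map_polyC hornerC. Qed.

Lemma ncevalM P P' : nceval (P * P') = nceval P * nceval P'.
Proof. exact: rmorphM. Qed.

Lemma ncevalX : nceval 'X = h.
Proof. by rewrite /nceval map_polyX hornerX. Qed.

End PolynomialValues.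

Section FractionScalars.
Variables (I : choiceType) (E : idomainType) (s : freealg I E).
Local Notation K := {fraction E}.
Local Notation "x %:F" := (@tofrac E x).

Lemma frac_scaleK (c : E) (x y : freealg I K) : c != 0 ->
  ncC c%:F * x = y -> x = ncC (c%:F)^-1 * y.
Proof.
move=> c0 <-; rewrite mulrA -ncCM mulVf ?rmorph1 ?mul1r //.
by rewrite tofrac_eq0.
Qed.

Lemma irreducible_over_fractions :
    (forall c x y, c != 0 -> x * y = ncC c * s -> exists a b x' y',
      [/\ x = ncC a * x', y = ncC b * y' & (nsize x' <= 1)%N \/ (nsize y' <= 1)%N]) ->
  forall x y : freealg I K, cmap (@tofrac E) s = x * y ->
  (exists c, x = ncC c) \/ (exists c, y = ncC c).
Proof.
move=> gauss x y xy; have [c [x' [c0 xx]]] := common_denominator_nc x.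
have [d [y' [d0 yy]]] := common_denominator_nc y.
have xy' : x' * y' = ncC (c * d) * s.
  apply: (cmap_inj (@tofrac_inj E)).
  have cd : cmap (@tofrac E) (ncC (c * d)) = ncC c%:F * ncC d%:F :> freealg I K.
    by rewrite -ncCM -tofracM cmapC.
  rewrite cmapM -xx -yy [RHS]cmapM cd xy.
  by rewrite -[LHS]mulrA -[RHS]mulrA (mulrA x) (ncC_comm _ x) !mulrA.
have [a [b [x1 [y1 [xr ys xy1]]]]] := gauss _ _ _ (mulf_neq0 c0 d0) xy'.
have const (z : freealg I K) z' z1 e t : e != 0 -> ncC e%:F * z = cmap (@tofrac E) z' ->
    z' = ncC t * z1 -> (nsize z1 <= 1)%N -> exists c, z = ncC c.
  move=> e0 /(frac_scaleK e0) -> -> /nsize_le1P[r ->].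
  by exists ((e%:F)^-1 * (t * r)%:F); rewrite -ncCM cmapC -ncCM.
case: xy1 => sz; [left|right].
  exact: const c0 xx xr sz.
exact: const d0 yy ys sz.
Qed.

End FractionScalars.

Section Eigenring.
Variables (I : choiceType) (k : comNzRingType) (E : idomainType).
Variables (iota : {rmorphism k -> E}) (theta : {rmorphism E -> freealg I k}) (t : E).
Hypothesis theta_iota : forall c, theta (iota c) = ncC c.
Local Notation K := {fraction E}.
Local Notation "x %:F" := (@tofrac E x).
Let s : freealg I E := cmap iota (theta t) - ncC t.
Hypothesis s_congr : forall q : E, exists y, ncC q = cmap iota (theta q) + s * y.

(** Left substitution picks, modulo right multiples of [s], a representative with coefficients in
    [k]. *)
Lemma lsub_congr (z : freealg I E) : exists y, z = cmap iota (lsub theta z) + s * y.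
Proof.
rewrite {1 2}[z]ncmonE; elim: (words z) => [|w r [y IHr]].
  by exists 0; rewrite !big_nil !raddf0 mulr0 addr0.
have [y' wE] := s_congr z@@w.
exists (y' * ncmon 1 w + y).
rewrite !big_cons (raddfD (lsub theta)) (raddfD (cmap iota)) /= IHr lsub_mon cmapM.
have -> : cmap iota (ncmon 1 w) = ncmon 1 w.
  by apply/ncP => u; rewrite coef_cmap !coef_mon rmorphMn rmorph1.
have -> : ncmon z@@w w = (cmap iota (theta z@@w) + s * y') * ncmon 1 w.
  by rewrite -wE -ncmonE1.
by rewrite -IHr mulrDl mulrDr mulrA -!addrA; congr (_ + _); rewrite addrCA -IHr.
Qed.

(* Left substitution maps the idealizer of s to the centralizer of theta t. *)
Lemma eigenring_scalar : (forall g, g * theta t = theta t * g -> exists q, g = theta q) ->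
  forall c c' : freealg I K, c * cmap (@tofrac E) s = cmap (@tofrac E) s * c' ->
  exists a z, c = ncC a + cmap (@tofrac E) s * z.
Proof.
move=> centf c c' cc'.
have [d [x [d0 xE]]] := common_denominator_nc c.
have [d' [x' [d'0 xE']]] := common_denominator_nc c'.
have xx' : ncC d' * x * s = s * (ncC d * x').
  apply: (cmap_inj (@tofrac_inj E)); rewrite !cmapM !cmapC -xE -xE'.
  transitivity (ncC (d'%:F * d%:F) * (cmap (@tofrac E) s * c')).
    by rewrite -cc' ncCM !mulrA.
  rewrite (mulrC d'%:F) ncCM [RHS]mulrA (ncC_comm _ (cmap _ s)) -!mulrA.
  by rewrite (mulrA (cmap _ s)) (ncC_comm _ (cmap _ s)) -mulrA.
pose g := lsub theta (ncC d' * x).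
have [y gE] := lsub_congr (ncC d' * x); rewrite -/g in gE.
have gshift : cmap iota g * s = s * (ncC d * x' - y * s).
  by rewrite [RHS]mulrBr -xx' [in RHS]gE mulrDl mulrA addrK.
(* Under the substitution the multiple of [s] dies, while in [g * s] the scalar [t] reappears to the
   left of [g] as [theta t]. *)
have gf : g * theta t = theta t * g.
  have := congr1 (lsub theta) gshift; rewrite lsub_kill // mulrBr raddfB /=.
  rewrite -cmapM (lsub_cmap theta_iota) ncC_comm lsubCM.
  by rewrite (lsub_cmap theta_iota) => /subr0_eq.
have [q gq] := centf g gf; have [y' qE] := s_congr q.
have {}gE : ncC d' * x = ncC q + s * (y - y').
  rewrite gE qE gq; have -> : s * (y - y') = s * y - s * y' by exact: mulrBr.
  by rewrite -addrA (addrC (s * y')) subrK.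
have dd0 : d' * d != 0 by exact: mulf_neq0.
have e : ncC (d' * d)%:F * c = ncC q%:F + cmap (@tofrac E) s * cmap (@tofrac E) (y - y').
  have := congr1 (cmap (@tofrac E)) gE; rewrite cmapM -xE cmapC (raddfD (cmap _)) /=.
  by rewrite cmapM !cmapC mulrA -ncCM tofracM.
exists ((d' * d)%:F^-1 * q%:F), (ncC (d' * d)%:F^-1 * cmap (@tofrac E) (y - y')).
by rewrite (frac_scaleK dd0 e) mulrDr -ncCM !mulrA ncC_comm.
Qed.

End Eigenring.

(** * Infinitely many reducible shifts *)

Section PolynomialDegree.
Variable (E : idomainType).
Implicit Types (p r : {poly E}).

Definition polydeg p : int := (size p).-1.

Lemma polydegM p r : p != 0 -> r != 0 -> polydeg (p * r) = polydeg p + polydeg r.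
Proof.
move=> p0 r0; rewrite /polydeg size_mul // -PoszD; congr Posz.
by move: p0 r0; rewrite -!size_poly_gt0; lia.
Qed.

Lemma polydegN p : polydeg (- p) = polydeg p.
Proof. by rewrite /polydeg size_polyN. Qed.

Lemma polydegD p r (m : int) : p != 0 -> r != 0 -> p + r != 0 ->
  polydeg p <= m -> polydeg r <= m -> polydeg (p + r) <= m.
Proof. by have := size_polyD p r; rewrite -!size_poly_gt0 /polydeg; lia. Qed.

End PolynomialDegree.

Section GenericShift.
Variables (I : finType) (k : closedFieldType) (f : freealg I k).
Local Notation P := {poly k}.
Local Notation K := {fraction P}.
Local Notation "x %:F" := (@tofrac P x).
Implicit Types (x y z : freealg I P).

Definition shiftX : freealg I P := cmap polyC f - ncC 'X.

Lemma generic_shiftE : generic_shift f = cmap (@tofrac P) shiftX.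
Proof.
apply/ncP => w; rewrite /shiftX coef_generic_shift coef_cmap nccoefB coef_cmap nccoefC.
by [].
Qed.

Lemma coef_shiftX w : shiftX@@w = shifted_coef f w.
Proof. by rewrite nccoefB coef_cmap nccoefC. Qed.

Lemma evaluation_eq0 (r : k) x : cmap (horner_eval r) x = 0 ->
  exists x', x = ncC ('X - r%:P) * x'.
Proof.
move=> xr; exists (\sum_(u <- undup (words x)) ncmon (x@@u %/ ('X - r%:P)) u).
apply/ncP => w; rewrite nccoefCM (coef_sum_words (g := fun u => x@@u %/ ('X - r%:P))).
  rewrite mulrC divpK // dvdp_XsubCl /root.
  by apply/eqP; have := coef_cmap (horner_eval r) x w; rewrite xr nccoef0.
by rewrite mem_words negbK => /eqP ->; rewrite div0p.
Qed.

(* Gauss's lemma: a scalar factor is removed root by root, since the ring of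
   noncommutative polynomials over k is a domain. *)
Lemma gauss_factorization (q : P) x y : q != 0 -> x * y = ncC q * shiftX ->
  exists r s x' y', [/\ x' * y' = shiftX, x = ncC r * x' & y = ncC s * y'].
Proof.
have [n] := ubnP (size q); elim: n q x y => // n IHn q x y sq q0 xy.
have [[c qc]|[r qr]] : (exists c, q = c%:P) \/ (exists r, root q r).
  have [q1|q1] := eqVneq (size q) 1%N; first by left; exists q`_0; apply/size1_polyC; rewrite q1.
  by right; exact/closed_rootP.
  have c0 : c != 0 by apply: contraNneq q0 => c0; rewrite qc c0.
  have [M [M' [qM MM MC]]] : exists M M' : freealg I P,
      [/\ ncC q = M, M * M' = 1 & forall g, g * M' = M' * g].
    exists (ncC c%:P), (ncC c^-1%:P); rewrite qc; split=> // [|g]; last exact: ncC_comm.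
    by rewrite -ncCM -polyCM divff // rmorph1.
  exists 1, q, x, (M' * y); rewrite rmorph1 mul1r qM; split=> //.
    by rewrite [LHS]mulrA MC -[LHS]mulrA xy qM [LHS]mulrA -MC MM mul1r.
  by rewrite [RHS]mulrA MM mul1r.
have /factor_theorem[q' qE] := qr.
have q'0 : q' != 0 by apply: contraNneq q0 => q'0; rewrite qE q'0 mul0r.
have sq' : (size q' < n)%N.
  by move: sq; rewrite qE size_Mmonic ?monicXsubC // size_XsubC addn2.
have [L LE] : exists L : freealg I P, L = ncC ('X - r%:P) by eexists.
have L0 : L != 0 by rewrite LE -nsize_gt0 nsizeC polyXsubC_eq0.
have LC g : g * L = L * g by rewrite LE ncC_comm.
have qL : ncC q = L * ncC q' by rewrite qE ncCM -LE LC.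
have evL x1 y1 : x1 * y1 = ncC q * shiftX -> (exists t, x1 = L * t) \/ (exists t, y1 = L * t).
  rewrite LE => xy1; have /eqP : cmap (horner_eval r) x1 * cmap (horner_eval r) y1 = 0.
    rewrite -rmorphM xy1 rmorphM /= cmapC.
    by rewrite [X in ncC X](_ : _ = 0) ?raddf0 ?mul0r //; apply/eqP.
  by rewrite nc_mulf_eq0 => /orP[] /eqP /evaluation_eq0; [left|right].
have [[t tE]|[t tE]] := evL x y xy.
  have ty : t * y = ncC q' * shiftX.
    by apply: (nc_mulfI L0); rewrite [LHS]mulrA -tE xy qL -[LHS]mulrA.
  have [a [b [x' [y' [xy' tE' yE]]]]] := IHn q' t y sq' q'0 ty.
  exists (('X - r%:P) * a), b, x', y'; split=> [//||//].
  by rewrite ncCM -LE -[RHS]mulrA -tE'.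
have xt : x * t = ncC q' * shiftX.
  apply: (nc_mulfI L0); rewrite [LHS]mulrA -LC -[LHS]mulrA -tE xy qL.
  by rewrite -[LHS]mulrA.
have [a [b [x' [y' [xy' xE tE']]]]] := IHn q' x t sq' q'0 xt.
exists a, (('X - r%:P) * b), x', y'; split=> [//|//|].
by rewrite ncCM -LE -[RHS]mulrA -tE'.
Qed.

(* The degree in 'X is additive, and for shiftX it is reached at the empty word
   only. *)
Lemma shiftX_irreducible x y : x * y = shiftX ->
  (nsize x <= 1)%N \/ (nsize y <= 1)%N.
Proof.
move=> xy; pose v := @polydeg k.
have s0 : shiftX@@[::] = (f@@[::])%:P - 'X by rewrite coef_shiftX.
have s0_size : size (shiftX@@[::]) = 2%N.
  by rewrite s0 -opprB size_polyN size_XsubC.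
have shift0 : shiftX != 0.
  by apply/eqP => h; move: s0_size; rewrite h nccoef0 size_poly0.
have x0 : x != 0 by apply: contraNneq shift0 => x0; rewrite -xy x0 mul0r.
have y0 : y != 0 by apply: contraNneq shift0 => y0; rewrite -xy y0 mulr0.
have [mx [u [xle [[xu xum] xmax]]]] := weight_exists v 0 x0.
have [my [w [yle [[yw ywm] ymax]]]] := weight_exists v 0 y0.
have [sle []] := weightM (@polydegM k) (@polydegN k) (@polydegD k)
  xle (conj (conj xu xum) xmax) yle (conj (conj yw ywm) ymax).
rewrite mul0n addr0 xy => suw suwm; rewrite xy in sle.
have := sle [::]; rewrite /vle mul0n subr0 -size_poly_eq0 s0_size /= /v /polydeg s0_size /= => m1.
(* Only the coefficient at the empty word involves ['X]; elsewhere [shiftX] has the coefficients of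
   [f], of degree 0. *)
have uw0 : u ++ w = [::].
  apply/eqP; apply: contraLR m1 => /negPf uw0.
  rewrite -suwm coef_shiftX /shifted_coef uw0 mulr0n subr0.
  by rewrite /v /polydeg size_polyC; case: eqP.
have [u0 w0] : u = [::] /\ w = [::] by case: (u) uw0.
(* A factor of degree 0 in ['X] reaches its weight at each of its words, so all of them are
   empty. *)
have const z m : wle v 0 z m -> m = 0 ->
    (forall w', reaches v 0 z m w' -> (size w' <= 0)%N) -> (nsize z <= 1)%N.
  move=> zm m0 zmax; apply/nsizeP => w' w'0; apply/eqP/negPn/negP => zw'.
  have := zmax w'; rewrite leqn0 => /(_ _)/eqP h; rewrite h // in w'0.
  by split=> //; have := zm w'; rewrite /vle (negPf zw') m0 mul0n subr0 /v /polydeg; lia.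
have vge (p : P) : 0 <= v p by [].
have m01 : mx = 0 \/ my = 0.
  move: suwm; rewrite -xum -ywm u0 w0 !mul0n !addr0 /= /v /polydeg s0_size.
  by move: (size _) (size _) => s1 s2; lia.
by case: m01 => m0; [left; apply: (const x mx) | right; apply: (const y my)];
  rewrite -?u0 // -?w0 //; rewrite u0 in xmax; rewrite w0 in ymax.
Qed.
End GenericShift.

(** The Horner step of [shiftX_congr]: [b] stands for [f], [t] for ['X] and [a] for the value
    accumulated so far. *)
Lemma ring_step (R : nzRingType) (a b c s t y : R) :
    s = b - t -> a * b = b * a -> a * t = t * a ->
  (a + s * y) * t + c = a * b + c + s * (y * t - a).
Proof.
move=> sE ab ta; have -> : s * (y * t - a) = s * y * t - (a * b - a * t).
  by rewrite mulrBr mulrA ab ta -mulrBl -sE.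
by rewrite mulrDl opprB (addrA _ (a * t)) addrCA (addrC (a * b)) addrK (addrC (a * t)) addrAC.
Qed.

Section EigenringOfGenericShift.
Variables (I : finType) (k : closedFieldType) (f : freealg I k).
Local Notation P := {poly k}.
Local Notation K := {fraction P}.

Lemma shiftX_congr (q : P) : exists y,
  ncC q = cmap polyC (nceval f q) + (cmap polyC (nceval f 'X) - ncC 'X) * y.
Proof.
rewrite ncevalX; elim/poly_ind: q => [|q c [y qE]].
  by exists 0; rewrite !raddf0 mulr0 addr0.
exists (y * ncC 'X - cmap polyC (nceval f q)).
have -> : ncC (q * 'X + c%:P) = ncC q * ncC 'X + ncC c%:P :> freealg I P.
  by rewrite raddfD /= ncCM.
have -> : nceval f (q * 'X + c%:P) = nceval f q * f + ncC c.
  by rewrite raddfD /= ncevalMX ncevalC.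
have -> : cmap polyC (nceval f q * f + ncC c) =
    cmap polyC (nceval f q) * cmap polyC f + ncC c%:P.
  by rewrite (raddfD (cmap polyC)) /= cmapM cmapC.
rewrite qE; apply: ring_step; [by [] | | exact: ncC_comm].
by rewrite -!cmapM -(nceval_comm q (erefl (f * f))).
Qed.

Lemma generic_shift_irreducible (x y : freealg I K) : generic_shift f = x * y ->
  (exists c, x = ncC c) \/ (exists c, y = ncC c).
Proof.
rewrite generic_shiftE; apply: irreducible_over_fractions => c x' y' c0 xy.
have [a [b [x1 [y1 [xy1 xE yE]]]]] := gauss_factorization c0 xy.
by exists a, b, x1, y1; split=> //; apply: shiftX_irreducible xy1.
Qed.

Lemma eigenring_generic_shift :
    (forall g, g * f = f * g -> exists q, g = nceval f q) ->
  forall c c' : freealg I K, c * generic_shift f = generic_shift f * c' ->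
  exists a z, c = ncC a + generic_shift f * z.
Proof.
move=> centf c c'; rewrite generic_shiftE.
have := @eigenring_scalar I k P polyC (nceval f) 'X (ncevalC f) shiftX_congr.
by rewrite /= ncevalX; apply.
Qed.

End EigenringOfGenericShift.

Lemma mul_through (R : nzRingType) (a b c d : R) : c * d = 1 -> a * b = a * c * (d * b).
Proof. by move=> cd; rewrite mulrA -(mulrA a) cd mulr1. Qed.

Section ReducibleShifts.
Variables (I : choiceType) (k : fieldType) (f : freealg I k).
Local Notation R := (freealg I k).

Definition nc_reducible (g : R) :=
  exists g1 g2 : R, [/\ (1 < nsize g1)%N, (1 < nsize g2)%N & g = g1 * g2].

Definition reducible_at (uv : seq I * seq I) (lam : k) (a b : R) :=
  [/\ f - ncC lam = a * b, (0 < size uv.1)%N, (nsize a <= (size uv.1).+1)%N,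
      (nsize b <= (size uv.2).+1)%N & b@@uv.2 = 1] /\
  (0 < size uv.2)%N /\ f@@(uv.1 ++ uv.2) != 0.

(** The concatenated top words of the factors form a nonempty word whose coefficient does not
    involve [lam], hence a word of [f]: finitely many pairs serve all [lam]. *)
Lemma nc_reducible_at lam : nc_reducible (f - ncC lam) ->
  exists uv a b, uv \in [seq (take i w, drop i w) | w <- words f, i <- iota 0 (size w).+1] /\
    reducible_at uv lam a b.
Proof.
case=> g1 [g2 [s1 s2 gE]].
have g10 : g1 != 0 by rewrite -nsize_gt0 ltnW.
have g20 : g2 != 0 by rewrite -nsize_gt0 ltnW.
have [u gu su] := nsize_attained g10; have [v gv sv] := nsize_attained g20.
have s1E : nsize g1 = (size u).+1 by rewrite su prednK // ltnW.
have s2E : nsize g2 = (size v).+1 by rewrite sv prednK // ltnW.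
have u0 : (0 < size u)%N by rewrite -ltnS -s1E.
have v0 : (0 < size v)%N by rewrite -ltnS -s2E.
have fuv : f@@(u ++ v) != 0.
  have : (g1 * g2)@@(u ++ v) != 0 by rewrite coefM_top ?s1E ?s2E // mulf_neq0.
  by rewrite -gE nccoefB nccoefC; case: (u) u0 => // x u' _; rewrite mulr0n subr0.
exists (u, v), (g1 * ncC g2@@v), (ncC (g2@@v)^-1 * g2); split.
  apply/allpairsPdep; exists (u ++ v), (size u); split.
  - by rewrite mem_words.
  - by rewrite mem_iota ltnS size_cat leq_addr.
  - by rewrite take_size_cat // drop_size_cat.
split=> //; split=> //=.
- by rewrite gE; apply: mul_through; rewrite -ncCM divff // (rmorph1 ncC).
- by rewrite -nc_mulC nsizeCM // s1E.
- by rewrite nsizeCM ?invr_eq0 // s2E.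
- by rewrite nccoefCM mulVf.
Qed.

Lemma finite_union (T : eqType) (X : T -> k -> Prop) (s : seq T) :
    (forall x, x \in s -> exists r : seq k, forall lam, X x lam -> lam \in r) ->
  exists r : seq k, forall x lam, x \in s -> X x lam -> lam \in r.
Proof.
elim: s => [|x s IHs] Xs; first by exists [::].
have [|r rP] := IHs; first by move=> y ys; apply: Xs; rewrite in_cons ys orbT.
have [r' r'P] := Xs x (mem_head _ _).
exists (r ++ r') => y lam; rewrite in_cons mem_cat => /predU1P[->|ys] Xl.
  by rewrite (r'P _ Xl) orbT.
by rewrite (rP _ _ ys Xl).
Qed.

End ReducibleShifts.

Section TopMatrix.
Variables (I : choiceType) (K : fieldType) (N : nat).
Variables (A : 'M[freealg I K]_N.+1) (u : seq I) (mu : K).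
Hypothesis mu0 : mu != 0.
Hypothesis A_size : forall i l, (nsize (A i l) <= (size u).+1)%N.
Hypothesis A_top : forall i l, (A i l)@@u = mu *+ (i == l).

(** For an entry [y j] of greatest degree with top word [w], the coefficient of [A *m y] at the
    nonempty word [u ++ w] is [mu] times a nonzero one. *)
Lemma top_matrix_constant (c : 'cV[K]_N.+1) (y : 'cV_N.+1) : (0 < size u)%N ->
  A *m y = map_mx ncC c -> c = 0.
Proof.
move=> u0 Ay; apply: NNPP => c0.
have y0 : exists j, y j 0 != 0.
  apply: NNPP => y0; case: c0; apply/colP => i; rewrite mxE.
  have := congr1 (fun Z : 'cV_N.+1 => nceps (Z i 0)) Ay; rewrite !mxE ncepsC => <-.
  rewrite big1 ?raddf0 // => l _; have [->|yl] := eqVneq (y l 0) 0; first by rewrite mulr0.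
  by case: y0; exists l.
have [j1 yj1] := y0; case: (@arg_maxnP _ j1 xpredT (fun j => nsize (y j 0))) => // j _ jmax.
have yj0 : y j 0 != 0.
  by rewrite -nsize_gt0 (leq_trans _ (jmax j1 isT)) // nsize_gt0.
have [w yw sw] := nsize_attained yj0.
have := congr1 (fun Z : 'cV_N.+1 => (Z j 0)@@(u ++ w)) Ay; rewrite !mxE nccoefC.
rewrite (_ : (u ++ w == [::]) = false); last by case: (u) u0.
have ysz l : (nsize (y l ord0) <= (size w).+1)%N.
  by rewrite sw prednK ?nsize_gt0 //; apply: jmax.
rewrite mulr0n nccoef_sum (bigD1 j) //= big1 => [|l lj].
  rewrite addr0 coefM_top // A_top eqxx mulr1n.
  by apply/eqP; rewrite mulf_neq0.
by rewrite coefM_top // A_top eq_sym (negPf lj) mulr0n mul0r.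
Qed.

(** A diagonal entry of [A] is nonzero, yet of smaller degree than [p]. *)
Lemma top_matrix_divisor p A' : ((size u).+1 < nsize p)%N -> A = p%:M *m A' -> False.
Proof.
move=> sp AE; have := congr1 (fun Z : 'M_N.+1 => Z 0 0) AE.
rewrite mul_scalar_mx !mxE => A00.
have A00u : (A 0 0)@@u != 0 by rewrite A_top eqxx mulr1n.
have A000 : A 0 0 != 0 by apply: contraNneq A00u => ->; rewrite nccoef0.
have A'0 : A' 0 0 != 0 by apply: contraNneq A000 => A'0; rewrite A00 A'0 mulr0.
have p0 : p != 0 by apply: contraNneq A000 => p0; rewrite A00 p0 mul0r.
have := A_size 0 0; rewrite A00 nsizeM // leqNgt => /negP; apply.
apply: leq_trans sp _; move: A'0; rewrite -nsize_gt0.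
by case: (nsize (A' _ _)) => // m _; rewrite addnS leq_addr.
Qed.

End TopMatrix.

Section InfinitelyManyReducible.
Variables (I : finType) (k : closedFieldType) (f : freealg I k).

Lemma factor_family_centralizer uv :
    (forall r : seq k, exists lam, lam \notin r /\ exists a b, reducible_at f uv lam a b) ->
  exists g, g * f = f * g /\ forall q, g <> nceval f q.
Proof.
case: uv => u v inf; apply: NNPP => cent.
have centf g : g * f = f * g -> exists q, g = nceval f q.
  by move=> gf; apply: NNPP => gq; apply: cent; exists g; split=> // q gE; apply: gq; exists q.
(* Indexing by all factorizations of the given type, not by [lam], avoids choosing one for each
   [lam]. *)
pose J := {x : k * freealg I k * freealg I k | reducible_at f (u, v) x.1.1 x.1.2 x.2}.
pose lam (j : J) := (sval j).1.1; pose a (j : J) := (sval j).1.2; pose b (j : J) := (sval j).2.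
have lam_inf (r : seq k) : exists j, lam j \notin r.
  by have [l [lr [x [y xy]]]] := inf r; exists (exist _ (l, x, y) xy).
have [j0 _] := lam_inf [::].
have [[_ u0 _ _ _] [v0 fuv]] := svalP j0.
rewrite /= in u0 v0 fuv.
have [||||N [A [B [AB Asz Atop]]]] :=
  @generic_factorization I k f J lam a b u v lam_inf _ u0 _ _ _ fuv.
- by move=> j; have [[]] := svalP j.
- by move=> j; have [[]] := svalP j.
- by move=> j; have [[]] := svalP j.
- by move=> j; have [[]] := svalP j.
pose mu := tofrac ((f@@(u ++ v))%:P); have mu0 : mu != 0.
  by rewrite tofrac_eq0 polyC_eq0.
have eps0 : nceps (generic_shift f) != 0.
  rewrite /nceps coef_generic_shift tofrac_eq0 /shifted_coef eqxx mulr1n.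
  by rewrite -size_poly_eq0 -opprB size_polyN size_XsubC.
case: (matrix_factorization (@generic_shift_irreducible _ _ f) eps0
         (@eigenring_generic_shift _ _ f centf) AB) => [[c [y [c0 Ay]]]|[A' AE]].
  case/eqP: c0; apply: (top_matrix_constant mu0 Asz _ u0 Ay) => i l.
  by rewrite Atop.
apply: (top_matrix_divisor mu0 Asz _ _ AE) => [i l|]; first by rewrite Atop.
have : (size (u ++ v) < nsize (generic_shift f))%N.
  apply: coef_neq0_size; rewrite coef_generic_shift tofrac_eq0 /shifted_coef.
  by case: (u) u0 fuv => // x u' _ fuv; rewrite mulr0n subr0 polyC_eq0.
by apply: leq_trans; rewrite size_cat ltnS -addn1 leq_add2l.
Qed.

Lemma infinitely_many_reducible_shifts :
    (forall r : seq k, exists lam, lam \notin r /\ nc_reducible (f - ncC lam)) ->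
  exists g, g * f = f * g /\ forall q, g <> nceval f q.
Proof.
move=> inf; set s := [seq (take i w, drop i w) | w <- words f, i <- iota 0 (size w).+1].
case: (classic (exists uv, uv \in s /\ forall r : seq k, exists lam, lam \notin r /\
    exists a b, reducible_at f uv lam a b)) => [[uv [_ uvP]]|noinf].
  exact: factor_family_centralizer uvP.
have [uv uvs|r rP] := finite_union
    (X := fun uv lam => exists a b, reducible_at f uv lam a b) (s := s).
  apply: NNPP => nor; apply: noinf; exists uv; split=> // r.
  apply: NNPP => nolam; apply: nor; exists r => lam lamP.
  by apply/negPn/negP => lr; apply: nolam; exists lam.
have [lam [lr /nc_reducible_at[uv [a [b [uvs uvP]]]]]] := inf r.
by case/negP: lr; apply: (rP uv) => //; exists a, b.
Qed.

End InfinitelyManyReducible.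

(** * Centralizers under extension of scalars *)

Section ScalarExtension.
Variables (I : choiceType) (k K : fieldType) (iota : {rmorphism k -> K}).
Implicit Types (g : freealg I K).

Lemma cmap_nceval (f : freealg I k) q :
  cmap iota (nceval f q) = nceval (cmap iota f) (map_poly iota q).
Proof.
elim/poly_ind: q => [|q c IHq]; first by rewrite !raddf0.
rewrite ncevalD ncevalMX ncevalC cmapD cmapM IHq cmapC.
by rewrite rmorphD rmorphM /= map_polyX map_polyC ncevalD ncevalMX ncevalC.
Qed.

(** As long as the scalars are dependent over [k], one is eliminated and its component absorbed into
    the others. *)
Lemma independent_decomposition g : exists n (l : 'I_n -> K) (G : 'I_n -> freealg I k),
  g = \sum_i ncC (l i) * cmap iota (G i) /\
  forall c : 'I_n -> k, \sum_i l i * iota (c i) = 0 -> forall i, c i = 0.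
Proof.
suff gen n : forall (l : 'I_n -> K) (G : 'I_n -> freealg I k),
    g = \sum_i ncC (l i) * cmap iota (G i) ->
    exists n (l : 'I_n -> K) (G : 'I_n -> freealg I k),
    g = \sum_i ncC (l i) * cmap iota (G i) /\
    forall c : 'I_n -> k, \sum_i l i * iota (c i) = 0 -> forall i, c i = 0.
  apply: (gen (size (words g)) (fun i => g@@(nth [::] (words g) i))
    (fun i => ncmon 1 (nth [::] (words g) i))).
  rewrite [LHS]ncmonE (big_nth [::]) big_mkord; apply: eq_bigr => i _.
  by apply/ncP => w; rewrite nccoefCM coef_cmap !coef_mon rmorphMn rmorph1 mulrnAr mulr1.
elim: n => [|n IHn] l G gE.
  by exists 0%N, l, G; split=> // c _ [].
case: (classic (forall c : 'I_n.+1 -> k, \sum_i l i * iota (c i) = 0 -> forall i, c i = 0)).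
  by exists n.+1, l, G.
case/not_all_ex_not => c notc; have [c0 /not_all_ex_not[j /eqP cj]] := imply_to_and _ _ notc.
apply: (IHn (fun i => l (lift j i)) (fun i => G (lift j i) - ncC (c (lift j i) / c j) * G j)).
have lj : l j = - \sum_i l (lift j i) * iota (c (lift j i) / c j).
  have ij : iota (c j) != 0 by rewrite fmorph_eq0.
  apply: (mulIf ij); apply/eqP; rewrite mulNr -addr_eq0 -[X in _ == X]c0 (bigD1_ord j) //=.
  rewrite mulr_suml; apply/eqP; congr (_ + _); apply: eq_bigr => i _.
  by rewrite rmorphM fmorphV -!mulrA mulVf // mulr1.
rewrite gE (bigD1_ord j) //= lj raddfN /= mulNr raddf_sum mulr_suml /= addrC.
rewrite -sumrB; apply: eq_bigr => i _.
by rewrite cmapB mulrBr cmapM cmapC ncCM mulrA.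
Qed.

(** Commuting with [f] is a linear condition over [k], so it passes to the components of [g] along
    independent scalars. *)
Lemma centralizer_scalar_extension (f : freealg I k) :
    (forall h : freealg I k, h * f = f * h -> exists q, h = nceval f q) ->
  forall g, g * cmap iota f = cmap iota f * g -> exists q, g = nceval (cmap iota f) q.
Proof.
move=> centf g gf; have [n [l [G [gE ind]]]] := independent_decomposition g.
have /fin_all_exists[q qE] i : exists q, G i = nceval f q.
  apply: centf; apply/ncP => w; apply/eqP; rewrite -subr_eq0 -nccoefB; apply/eqP.
  move: i; apply: (ind (fun i => (G i * f - f * G i)@@w)).
  have gfw : (g * cmap iota f - cmap iota f * g)@@w = 0 by rewrite gf subrr nccoef0.
  apply: etrans gfw; rewrite gE mulr_suml mulr_sumr -sumrB nccoef_sum; apply: eq_bigr => i _.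
  rewrite -coef_cmap -nccoefCM cmapB mulrBr !cmapM !mulrA.
  by rewrite (ncC_comm _ (cmap iota f)).
exists (\sum_i l i *: map_poly iota (q i)).
rewrite gE raddf_sum; apply: eq_bigr => i _ /=.
by rewrite qE cmap_nceval -mul_polyC ncevalM ncevalC.
Qed.

End ScalarExtension.

(** * Elements commuting with a commutative subring *)

Section FractionValuation.
Variables (E : idomainType) (v : E -> int).
Hypothesis vM : forall x y : E, x != 0 -> y != 0 -> v (x * y) = v x + v y.
Hypothesis vN : forall x : E, v (- x) = v x.
Hypothesis vD : forall (x y : E) (m : int), x != 0 -> y != 0 -> x + y != 0 ->
  v x <= m -> v y <= m -> v (x + y) <= m.
Local Notation K := {fraction E}.
Local Notation "x %:F" := (@tofrac E x).

Definition numden (x : K) : E * E :=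
  proj1_sig (constructive_indefinite_description
    (fun nd : E * E => nd.2 != 0 /\ x = nd.1%:F / nd.2%:F)
    (match fractionE x with ex_intro n (ex_intro d h) => ex_intro _ (n, d) h end)).

Lemma numdenP x : (numden x).2 != 0 /\ x = (numden x).1%:F / (numden x).2%:F.
Proof. by rewrite /numden; case: constructive_indefinite_description. Qed.

(** By [fracv_div] the value at a nonzero fraction does not depend on the representative chosen by
    [numden]. *)
Definition fracv x : int := v (numden x).1 - v (numden x).2.

Lemma frac_neq0 n d : n != 0 -> d != 0 -> n%:F / d%:F != 0.
Proof. by move=> n0 d0; rewrite mulf_neq0 ?invr_eq0 ?tofrac_eq0. Qed.

Lemma fracv_div n d : n != 0 -> d != 0 -> fracv (n%:F / d%:F) = v n - v d.
Proof.
move=> n0 d0; have [d'0 e] := numdenP (n%:F / d%:F).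
rewrite /fracv; move: (numden _).1 (numden _).2 d'0 e => n' d' d'0 e.
have n'0 : n' != 0.
  by apply: contraNneq (frac_neq0 n0 d0) => n'0; rewrite e n'0 rmorph0 mul0r.
have nd : n * d' = n' * d.
  apply: tofrac_inj; rewrite !rmorphM /=; apply/eqP.
  by rewrite -eqr_div ?tofrac_eq0 // e.
by have := congr1 v nd; rewrite !vM //; lia.
Qed.

Lemma v1 : v 1 = 0.
Proof. by have := vM (oner_neq0 E) (oner_neq0 E); rewrite mulr1; move: (v 1) => x; lia. Qed.

Lemma fracv_tofrac n : n != 0 -> fracv n%:F = v n.
Proof.
by move=> n0; rewrite -[n%:F]divr1 -(rmorph1 (@tofrac E)) fracv_div ?oner_neq0 // v1 subr0.
Qed.

Lemma fracE x : x != 0 -> exists n d, [/\ n != 0, d != 0 & x = n%:F / d%:F].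
Proof.
move=> x0; have [n [d [d0 xE]]] := fractionE x; exists n, d; split=> //.
by apply: contraNneq x0 => n0; rewrite xE n0 rmorph0 mul0r.
Qed.

Lemma fracvM x y : x != 0 -> y != 0 -> fracv (x * y) = fracv x + fracv y.
Proof.
move=> /fracE[n [d [n0 d0 ->]]] /fracE[n' [d' [n'0 d'0 ->]]].
rewrite mulf_div -!tofracM !fracv_div ?mulf_neq0 // !vM //; lia.
Qed.

Lemma fracvN x : fracv (- x) = fracv x.
Proof.
have [->|] := eqVneq x 0; first by rewrite oppr0.
case/fracE => n [d [n0 d0 ->]]; rewrite -mulNr -tofracN.
by rewrite !fracv_div ?oppr_eq0 // vN.
Qed.

Lemma fracvD x y (m : int) : x != 0 -> y != 0 -> x + y != 0 ->
  fracv x <= m -> fracv y <= m -> fracv (x + y) <= m.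
Proof.
move=> /fracE[n [d [n0 d0 ->]]] /fracE[n' [d' [n'0 d'0 ->]]].
rewrite addf_div ?tofrac_eq0 // -!tofracM -tofracD => s0.
have {}s0 : n * d' + n' * d != 0.
  by apply: contraNneq s0 => ->; rewrite rmorph0 mul0r.
rewrite !fracv_div ?mulf_neq0 // vM // => nm n'm.
have : v (n * d' + n' * d) <= m + (v d + v d').
  by apply: vD; rewrite ?mulf_neq0 // vM //; move: nm n'm; rewrite !lerBlDr; lia.
by rewrite lerBlDr.
Qed.

End FractionValuation.

Lemma mul_shuffle (R : comNzRingType) (c x y z : R) : c * (x * y * z) = y * (c * (x * z)).
Proof. by ring. Qed.

Section BoundedPowers.
Variables (I : choiceType) (E : idomainType).
Local Notation K := {fraction E}.
Local Notation "x %:F" := (@tofrac E x).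
Variables (a b : freealg I K) (v0 : seq I).
Hypothesis ab_integral : forall w, exists c, (a * b)@@w = c%:F.
Hypothesis b_unit : b@@v0 = 1.

Let integral (x : K) := exists c, x = c%:F.

Let integralM x y : integral x -> integral y -> integral (x * y).
Proof. by case=> c -> [e ->]; exists (c * e); rewrite tofracM. Qed.

Let integralB x y : integral x -> integral y -> integral (x - y).
Proof. by case=> c -> [e ->]; exists (c - e); rewrite tofracB. Qed.

Let q := (size (words b)).-1.

Let v0_words : v0 \in words b.
Proof. by rewrite mem_words b_unit oner_eq0. Qed.

(** Dedekind-Mertens for a family of one member: since [a * b] has coefficients in [E] and [b] has a
    coefficient 1, a product of [q + 1] coefficients of [a] is a combination over [E] of products of
    [q] of them. A denominator for those serves every length. *)
Lemma products_bounded : exists c : E, c != 0 /\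
  forall s : seq (seq I), integral (c%:F * \prod_(u <- s) a@@u).
Proof.
have [c1 [z1 [c10 cz1]]] :=
  common_denominator (fun i : 'I_(size (words a)) => a@@(nth [::] (words a) i)).
have coef_int u : integral (c1%:F * a@@u).
  have [ua|] := boolP (u \in words a); last first.
    by rewrite mem_words negbK => /eqP ->; exists 0; rewrite mulr0 rmorph0.
  have lt : (index u (words a) < size (words a))%N by rewrite index_mem.
  by exists (z1 (Ordinal lt)); rewrite -cz1 /= nth_index.
exists (c1 ^+ q); split=> [|s]; first by rewrite expf_neq0.
pose J := unit.
have short s' : (size s' <= q)%N -> integral ((c1 ^+ q)%:F * \prod_(u <- s') a@@u).
  move=> sq; rewrite -(subnK sq) exprD tofracM -mulrA; apply: integralM; first by eexists.
  elim: s' {sq} => [|u s' IHs]; first by exists 1; rewrite expr0 big_nil mulr1.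
  rewrite big_cons exprS tofracM mulrACA; apply: integralM => //.
have [n] := ubnP (size s); elim: n s => // n IHn s sn.
have [/short //|qs] := leqP (size s) q.
(* The first [q + 1] factors are rewritten while [H] keeps the remaining ones, [s2], as a
   multiplier; this shortens the product by one. *)
rewrite -[s](cat_take_drop q.+1) big_cat /=; set s2 := drop _ _.
pose H (x : unit -> K) := integral ((c1 ^+ q)%:F * (x tt * \prod_(u <- s2) a@@u)).
have HB x y z : H x -> H y -> (forall j, z j = x j - y j) -> H z.
  move=> Hx Hy zE; rewrite /H zE mulrBl mulrBr; exact: integralB.
have sT : (size (words b) <= q.+1)%N.
  by rewrite prednK //; case: (words b) v0_words.
have suppa : supported (words a) (fun _ : unit => a).
  by move=> _ w; rewrite mem_words negbK => /eqP.
have suppb : supported (words b) (fun _ : unit => b).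
  by move=> _ w; rewrite mem_words negbK => /eqP.
have Hab w s' : size s' = q -> H (fun j => coefprod (fun=> a) s' j * (a * b)@@w).
  move=> ss'; rewrite /H /coefprod.
  have -> : (c1 ^+ q)%:F * (\prod_(u <- s') a@@u * (a * b)@@w * \prod_(u <- s2) a@@u) =
      (a * b)@@w * ((c1 ^+ q)%:F * \prod_(u <- s' ++ s2) a@@u).
    by rewrite big_cat; apply: mul_shuffle.
  apply: integralM (ab_integral w) _.
  apply: IHn; rewrite size_cat ss' size_drop; move: qs sn; lia.
have := dedekind_mertens HB suppa suppb sT Hab v0 (s := take q.+1 s).
rewrite /H b_unit mulr1 /coefprod; apply.
by rewrite size_take_min; apply/minn_idPl.
Qed.

Lemma powers_bounded : exists c : E, c != 0 /\
  forall u (z : E) n, exists e, c%:F * (a@@u - z%:F) ^+ n = e%:F.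
Proof.
have [c [c0 cP]] := products_bounded; exists c; split=> // u z n.
rewrite exprDn mulr_sumr.
have intD x y : integral x -> integral y -> integral (x + y).
  by case=> e -> [e' ->]; exists (e + e'); rewrite tofracD.
apply: (big_ind integral) => // [|i _]; first by exists 0; rewrite tofrac0.
rewrite -mulrnAr mulrA; apply: integralM.
  by have := cP (nseq (n - i) u); rewrite big_nseq iter_mulr_1.
by exists ((- z) ^+ i *+ 'C(n, i)); rewrite tofracMn tofracXn tofracN.
Qed.

End BoundedPowers.

Lemma comm_sub (R : nzRingType) (x y c d : R) : x * y = y * x ->
  (forall z, z * c = c * z) -> (forall z, z * d = d * z) ->
  (x - c) * (y - d) = (y - d) * (x - c).
Proof.
move=> xy cz dz; rewrite !mulrBl !mulrBr xy (cz y) (dz x) (dz c).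
by rewrite !opprB addrACA [- _ + _]addrC [RHS]addrACA; congr (_ + _); rewrite addrC.
Qed.

Lemma sub_mul_division (R : nzRingType) (x h r c d : R) :
  x * h + r - d - (x - c) * h = r - d + c * h.
Proof.
rewrite mulrBl opprB -(addrA (x * h)) (addrC (x * h)) -[LHS]addrA.
by rewrite (addrC (x * h)) subrK.
Qed.

Lemma cmap_comm (I : choiceType) (E E' : nzRingType) (phi : {rmorphism E -> E'})
    (x y : freealg I E) :
  x * y = y * x -> cmap phi x * cmap phi y = cmap phi y * cmap phi x.
Proof. by move=> xy; rewrite -cmapM xy cmapM. Qed.

Lemma normalized_left_factor (I : choiceType) (K : fieldType) (g1 g2 y1 y2 : freealg I K) :
  g1 * y1 = g2 * y2 -> g1 * y1 != 0 ->
  exists a b b' s t v, [/\ g1 = a * b, g2 = a * b', a = g1 * s + g2 * t &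
    b@@v = 1 /\ nsize b = (size v).+1].
Proof.
move=> e ne; have [a [s [t [b [b' [aE g1E g2E]]]]]] := common_left_factor e ne.
have b0 : b != 0.
  by apply: contraNneq ne => b0; rewrite g1E b0 mulr0 mul0r.
have [v bv sv] := nsize_attained b0.
have inv : ncC b@@v * ncC (b@@v)^-1 = 1 :> freealg I K by rewrite -rmorphM divff ?rmorph1.
exists (a * ncC b@@v), (ncC (b@@v)^-1 * b), (ncC (b@@v)^-1 * b'), (s * ncC b@@v), (t * ncC b@@v), v.
split.
- by rewrite -(mul_through _ _ inv).
- by rewrite -(mul_through _ _ inv).
- by rewrite {1}aE mulrDl !mulrA.
- by rewrite nccoefCM mulVf // nsizeCM ?invr_eq0 // sv prednK // nsize_gt0.
Qed.

Lemma clear_denominators (R R' : nzRingType) (F : {rmorphism R -> R'})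
    (g g' x y s' t' : R) (x1 y1 a s t : R') :
  (forall z, z * x1 = x1 * z) -> (forall z, z * y1 = y1 * z) ->
  F x = x1 -> F y = y1 -> x1 * s = F s' -> y1 * t = F t' ->
  a = F g * s + F g' * t ->
  x1 * y1 * a = F (g * (y * s') + g' * (x * t')).
Proof.
move=> xz yz Fx Fy sE tE ->.
rewrite rmorphD !rmorphM Fx Fy -sE -tE.
have gxy z : x1 * y1 * z = z * x1 * y1 by rewrite -mulrA -(yz z) mulrA -(xz z).
by rewrite mulrDr !mulrA !gxy -(mulrA (F g)) -(xz y1) mulrA.
Qed.

Lemma least_nat (P : nat -> Prop) n : P n ->
  exists m, [/\ P m, (m <= n)%N & forall j, P j -> (m <= j)%N].
Proof.
have [N] := ubnP n; elim: N n => // N IHN n nN Pn.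
case: (classic (exists2 j, P j & (j < n)%N)) => [[j Pj jn]|no]; last first.
  by exists n; split=> // j Pj; rewrite leqNgt; apply/negP => jn; apply: no; exists j.
have [m [Pm mj mmin]] := IHN j (leq_trans jn (ltnSE nN)) Pj.
by exists m; split=> //; apply: leq_trans mj (ltnW jn).
Qed.

Section CommutativeSubring.
Variables (I : choiceType) (k : fieldType) (C : idomainType).
Variables (iota : {rmorphism k -> C}) (theta : {rmorphism C -> freealg I k}).
Hypothesis theta_iota : forall c, theta (iota c) = ncC c.
Hypothesis theta_inj : injective theta.
Local Notation D := {fraction C}.
Local Notation "x %:F" := (@tofrac C x).
Implicit Types (c x y : C).

Definition ncdeg x : int := (nsize (theta x)).-1.

Lemma theta_eq0 x : (theta x == 0) = (x == 0).
Proof. by rewrite -(inj_eq theta_inj) rmorph0. Qed.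

Lemma ncdegM x y : x != 0 -> y != 0 -> ncdeg (x * y) = ncdeg x + ncdeg y.
Proof.
move=> x0 y0; rewrite /ncdeg rmorphM nsizeM ?theta_eq0 // -PoszD; congr Posz.
have : (0 < nsize (theta x))%N by rewrite nsize_gt0 theta_eq0.
have : (0 < nsize (theta y))%N by rewrite nsize_gt0 theta_eq0.
by case: (nsize (theta x)) (nsize (theta y)) => [|m] [|n] // _ _; rewrite addSn addnS.
Qed.

Lemma ncdegN x : ncdeg (- x) = ncdeg x.
Proof. by rewrite /ncdeg rmorphN nsizeN. Qed.

Lemma ncdegD x y (m : int) : x != 0 -> y != 0 -> x + y != 0 ->
  ncdeg x <= m -> ncdeg y <= m -> ncdeg (x + y) <= m.
Proof.
move=> _ _ _ xm ym; rewrite /ncdeg rmorphD; have := nsizeD (theta x) (theta y).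
rewrite /ncdeg in xm ym; move: xm ym.
by move: (nsize _) (nsize _) (nsize _) => a b c; lia.
Qed.

Local Notation v := (fracv ncdeg).
Let vM := fracvM ncdegM.
Let vN := fracvN ncdegM ncdegN.
Let vD := fracvD ncdegM ncdegD.
Local Notation vle := (vle v).

Lemma ncdeg_ge0 x : 0 <= ncdeg x. Proof. by []. Qed.

Lemma ncdeg_iota e : ncdeg (iota e) = 0.
Proof. by rewrite /ncdeg theta_iota nsizeC; case: eqP. Qed.

Lemma iota_eq0 e : (iota e == 0) = (e == 0).
Proof. by rewrite -theta_eq0 theta_iota -nsize_eq0 nsizeC; case: (e == 0). Qed.

Lemma v_iota e : e != 0 -> v (iota e)%:F = 0.
Proof. by move=> e0; rewrite fracv_tofrac ?iota_eq0 ?ncdeg_iota //; apply: ncdegM. Qed.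

Lemma v_tofrac c : c != 0 -> v c%:F = ncdeg c.
Proof. by apply: fracv_tofrac; apply: ncdegM. Qed.

Lemma theta_comm x y : theta x * theta y = theta y * theta x.
Proof. by rewrite -!rmorphM mulrC. Qed.

(* The residue field of the valuation is k, by division in the free algebra. *)
Lemma residue (x : D) : vle x 0 -> exists e, vle (x - (iota e)%:F) (- 1).
Proof.
rewrite /vle; have [->|x0 /=] := eqVneq x 0; first by exists 0; rewrite !rmorph0 subrr eqxx.
have [n [d [n0 d0 xE]]] := fracE x0.
rewrite {1}xE (fracv_div ncdegM) // => nd.
have td0 : theta d != 0 by rewrite theta_eq0.
have [h hlt] := division (theta_comm n d) td0 td0.
have [e hE] : exists e, h = ncC e.
  apply/nsize_le1P; have [->|h0] := eqVneq h 0; first by rewrite nsize0.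
  have sdh := nsizeM td0 h0; have := nsizeB (theta n) (theta n - theta d * h).
  rewrite opprB addrCA subrr addr0 {}sdh.
  have dn : ((nsize (theta n)).-1 <= (nsize (theta d)).-1)%N.
    by move: nd; rewrite subr_le0 lez_nat.
  move: hlt dn h0 td0; rewrite -!nsize_gt0.
  move: (nsize (theta n)) (nsize (theta d)) (nsize h) (nsize (_ - _)) => a b e r.
  by lia.
exists e; have [//|y0] := eqVneq (x - (iota e)%:F) 0; rewrite /=.
have yE : x - (iota e)%:F = (n - iota e * d)%:F / d%:F.
  by rewrite xE tofracB mulrBl tofracM mulfK ?tofrac_eq0.
have z0 : n - iota e * d != 0.
  by apply: contraNneq y0 => z0; rewrite yE z0 rmorph0 mul0r.
rewrite yE (fracv_div ncdegM) // /ncdeg rmorphB rmorphM theta_iota -ncC_comm -hE.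
move: z0 hlt td0; rewrite -theta_eq0 rmorphB rmorphM theta_iota -ncC_comm -hE -!nsize_gt0.
rewrite lerBlDr; move: (nsize (_ - _)) (nsize (theta d)) => a b.
by lia.
Qed.

(** If [y] were nonzero, the degree of [c%:F * y ^+ n] would be at most that of [c] minus [n],
    negative for large [n], while elements of [C] have nonnegative degree. *)
Lemma integral_const (x : D) c (e : k) : c != 0 -> vle (x - (iota e)%:F) (- 1) ->
  (forall n, exists c', c%:F * (x - (iota e)%:F) ^+ n = c'%:F) -> x = (iota e)%:F.
Proof.
move=> c0; set y := x - _; rewrite /vle => /orP[/eqP/subr0_eq //|yv int].
apply/eqP; rewrite -subr_eq0 -/y; apply/negPn/negP => y0.
have vX n : v (y ^+ n) = v y *+ n.
  elim: n => [|n IHn]; first by rewrite expr0 mulr0n -tofrac1 -(rmorph1 iota) v_iota ?oner_neq0.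
  by rewrite exprS vM ?expf_neq0 // IHn mulrS.
have [c' cE] := int (nsize (theta c)).
have c'0 : c' != 0.
  by rewrite -tofrac_eq0 -cE mulf_neq0 ?expf_neq0 // tofrac_eq0.
have := congr1 v cE; rewrite vM ?expf_neq0 ?tofrac_eq0 // !v_tofrac // vX.
move=> e1.
have vle_n n : v y *+ n <= - n%:Z.
  elim: n => [|n IHn]; first by rewrite mulr0n oppr0.
  by rewrite mulrS; move: IHn yv; move: (v y *+ n) (v y) => p q; lia.
suff : ncdeg c' < 0 by rewrite ltNge ncdeg_ge0.
rewrite -e1; apply: le_lt_trans (lerD (lexx _) (vle_n _)) _.
have : (0 < nsize (theta c))%N by rewrite nsize_gt0 theta_eq0.
by rewrite subr_lt0 /ncdeg ltz_nat; case: (nsize _).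
Qed.

Definition opdiff c : freealg I C := cmap iota (theta c) - ncC c.
Local Notation S c := (cmap (@tofrac C) (opdiff c)).

Lemma opdiffC x y : opdiff x * opdiff y = opdiff y * opdiff x.
Proof.
apply: comm_sub => [|z|z]; last 2 first.
- exact: ncC_comm.
- exact: ncC_comm.
by apply: cmap_comm; apply: theta_comm.
Qed.

Lemma coef_opdiff c w : w != [::] -> (opdiff c)@@w = iota (theta c)@@w.
Proof. by move=> /negPf w0; rewrite nccoefB coef_cmap nccoefC w0 mulr0n subr0. Qed.

Lemma coef_opdiff_frac c w : w != [::] -> (S c)@@w = (iota (theta c)@@w)%:F.
Proof. by move=> w0; rewrite coef_cmap coef_opdiff. Qed.

Lemma opdiff_neq0 c : 0 < ncdeg c -> S c != 0.
Proof.
move=> c0; have t0 : theta c != 0.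
  by apply: contraTneq c0; rewrite /ncdeg => ->; rewrite nsize0.
have [w tw sw] := nsize_attained t0.
have w0 : w != [::] by apply: contraTneq c0; rewrite /ncdeg -sw => ->.
apply: contraNneq tw => S0; move: (coef_opdiff_frac c w0); rewrite S0 nccoef0 => /esym/eqP.
by rewrite tofrac_eq0 iota_eq0.
Qed.

Lemma vle_iota e (m : int) : 0 <= m -> vle (iota e)%:F m.
Proof.
rewrite /vle tofrac_eq0 iota_eq0; case: eqP => // /eqP e0.
by rewrite v_iota.
Qed.

Lemma vle_tofrac c m : ncdeg c <= m -> vle c%:F m.
Proof.
by rewrite /vle tofrac_eq0; case: eqP => // /eqP c0; rewrite v_tofrac.
Qed.

(** Coefficients in [k] have degree 0, so a word of [theta c] weighs its length; the scalar [c]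
    weighs its degree at the empty word. *)
Lemma wle_opdiff c : wle v 1 (S c) (ncdeg c).
Proof.
move=> w; have [->|w0] := eqVneq w [::].
  rewrite muln0 subr0 coef_cmap nccoefB nccoefC coef_cmap mulr1n rmorphB.
  apply: (vle_add vD); first exact: vle_iota.
  by rewrite (vle_opp vN) vle_tofrac.
rewrite coef_opdiff_frac //; have [tw|tw] := eqVneq (theta c)@@w 0.
  by rewrite tw !rmorph0 /vle eqxx.
apply: vle_iota; have := coef_neq0_size tw; rewrite mul1n subr_ge0 /ncdeg lez_nat.
by case: (nsize _).
Qed.

Section SmallestGap.
Variable c1 : C.
Hypothesis c1_gt0 : 0 < ncdeg c1.

(* The weight, degree of the coefficient plus length of the word, is additive. *)
Lemma left_factor_weight a b v0 : S c1 = a * b -> b@@v0 = 1 -> nsize b = (size v0).+1 ->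
  exists r u, [/\ nsize a = r.+1, wle v 1 a r%:Z, longest_reach v 1 a r%:Z u & size u = r].
Proof.
move=> ab bv sb; have S0 := opdiff_neq0 c1_gt0.
have a0 : a != 0 by apply: contraNneq S0 => a0; rewrite ab a0 mul0r.
have b0 : b != 0 by apply: contraNneq S0 => b0; rewrite ab b0 mulr0.
have [u au su] := nsize_attained a0.
have sa : nsize a = (size u).+1 by rewrite su prednK // nsize_gt0.
have deg_le : ((nsize (theta c1)).-1 <= size u + size v0)%N.
  have t0 : theta c1 != 0.
    by apply: contraTneq c1_gt0; rewrite /ncdeg => ->; rewrite nsize0.
  have [w tw sw] := nsize_attained t0.
  have w0 : w != [::] by apply: contraTneq c1_gt0; rewrite /ncdeg -sw => ->.
  have : (S c1)@@w != 0 by rewrite coef_opdiff_frac // tofrac_eq0 iota_eq0.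
  by move/coef_neq0_size; rewrite sw ab nsizeM // sa sb addSn addnS.
exists (size u), u.
have uv0 : u ++ v0 != [::].
  rewrite -size_eq0 size_cat; move: c1_gt0 deg_le; rewrite /ncdeg ltz_nat.
  by move: (nsize _) (_ + _)%N => p q; lia.
(* At the nonempty word [u ++ v0] the coefficient of [S c1] comes from [k], so [u] weighs exactly
   its length in [a]. *)
have au_k : a@@u = (iota (theta c1)@@(u ++ v0))%:F.
  by rewrite -coef_opdiff_frac // ab coefM_top ?sa ?sb // bv mulr1.
have va : v a@@u = 0.
  move: au; rewrite au_k tofrac_eq0 iota_eq0.
  exact: v_iota.
have [ma [ua [wa la]]] := weight_exists v 1 a0.
have [mb [ub [wb lb]]] := weight_exists v 1 b0.
have [_ rab] := weightM vM vN vD wa la wb lb.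
have ra : reaches v 1 a (size u) u by split; rewrite // va add0r mul1n.
have rb : reaches v 1 b (size v0) v0.
  split; first by rewrite bv oner_eq0.
  by rewrite bv mul1n -tofrac1 -(rmorph1 iota) v_iota ?oner_eq0 // add0r.
have le1 := reaches_wle wa ra; have le2 := reaches_wle wb rb.
have le3 : ma + mb <= ncdeg c1 by apply: reaches_wle (wle_opdiff c1) _; rewrite ab; exact: rab.
(* The two weights are at least [size u] and [size v0], and their sum is at most the degree of [c1],
   itself at most [size u + size v0]. *)
have maE : ma = size u.
  move: deg_le le1 le2 le3; rewrite /ncdeg; move: (nsize _) (size u) (size v0) => p q r.
  by lia.
split=> //; first by rewrite -maE.
split=> // w [aw _]; rewrite -ltnS -sa; exact: coef_neq0_size.
Qed.

Variables (c2 : C) (delta : nat).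
Hypothesis delta_gt0 : (0 < delta)%N.
Hypothesis c12 : ncdeg c2 = ncdeg c1 + delta%:Z.
Hypothesis delta_min : forall x y, x != 0 -> y != 0 ->
  ncdeg x < ncdeg y -> ncdeg x + delta%:Z <= ncdeg y.

(** The values are differences of degrees, and none lies strictly between 0 and [delta]. *)
Lemma v_gap (x : D) (m : int) : vle x m -> m < delta%:Z -> vle x 0.
Proof.
rewrite /vle; have [//|x0 /=] := eqVneq x 0.
have [n [d [n0 d0 ->]]] := fracE x0; rewrite (fracv_div ncdegM) //.
have := @delta_min d n d0 n0; clear; move: (ncdeg n) (ncdeg d) => p q; lia.
Qed.

(* Dividing theta c2 by theta c1 gives a left multiple of a whose weight is
   reached at words of length at most delta only. *)
Lemma left_factor_size a b' r u : S c2 = a * b' -> (exists b, S c1 = a * b) ->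
  wle v 1 a r%:Z -> longest_reach v 1 a r%:Z u -> size u = r -> (r <= delta)%N.
Proof.
move=> ab2 [b ab1] wa la su.
have c2_gt0 : 0 < ncdeg c2 by move: c1_gt0; rewrite c12; lia.
have t1 : theta c1 != 0.
  by apply: contraTneq c1_gt0; rewrite /ncdeg => ->; rewrite nsize0.
have c10 : c1 != 0 by rewrite -theta_eq0.
have [h hlt] := division (theta_comm c2 c1) t1 t1.
set r1 := theta c2 - _ in hlt.
have t2E : theta c2 = theta c1 * h + r1 by rewrite addrC subrK.
have h0 : h != 0.
  apply: contraTneq hlt; rewrite /r1 => ->; rewrite mulr0 subr0 -leqNgt.
  by move: c12 delta_gt0; rewrite /ncdeg; move: (nsize _) (nsize _) => p q; lia.
have sth := nsizeM t1 h0.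
have sh : nsize h = delta.+1.
  have st2 := nsizeD (theta c1 * h) r1; rewrite -t2E in st2.
  have sth2 := nsizeB (theta c2) r1; rewrite {1}t2E addrK in sth2.
  move: c12 delta_gt0 c1_gt0 h0 t1 sth st2 sth2 hlt; rewrite /ncdeg -!nsize_gt0.
  move: (nsize (theta c1)) (nsize (theta c2)) (nsize h) (nsize r1) (nsize (_ * _)).
  by move=> p q x y z; lia.
(* This is [opdiff c2 - opdiff c1 * h], again a right multiple of [a] over the fractions; the
   product [theta c1 * h] has cancelled. *)
pose y : freealg I C := cmap iota r1 - ncC c2 + ncC c1 * cmap iota h.
have yE : opdiff c2 - opdiff c1 * cmap iota h = y.
  rewrite /opdiff {1}t2E cmapD cmapM; exact: sub_mul_division.
have coef_y w : w != [::] -> y@@w = iota r1@@w + c1 * iota h@@w.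
  move=> /negPf w0; rewrite /y nccoefD nccoefB nccoefCM !coef_cmap nccoefC w0 mulr0n.
  by rewrite subr0.
have [q YE] : exists q, cmap (@tofrac C) y = a * q.
  exists (b' - b * cmap (@tofrac C) (cmap iota h)).
  by rewrite mulrBr -ab2 mulrA -ab1 -cmapM -cmapB yE.
have [w hw sw] := nsize_attained h0; rewrite sh /= in sw.
have w0 : w != [::] by rewrite -size_eq0 sw -lt0n.
(* At a top word of [h] the constant from [r1] cannot cancel [c1] times a nonzero constant, so [y]
   has weight at least the degree of [c2]. *)
have [yw0 yw_deg] : y@@w != 0 /\ ncdeg c1 <= ncdeg y@@w.
  have : (nsize (theta c1) <= maxn (nsize (theta y@@w)) 1)%N.
    rewrite -(nsizeCM _ hw) nc_mulC -theta_iota -rmorphM.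
    rewrite -[c1 * _](addKr (iota r1@@w)) -coef_y // [- _ + _]addrC rmorphB theta_iota.
    apply: leq_trans (nsizeB _ _) _; rewrite geq_max leq_maxl nsizeC.
    by rewrite (leq_trans (leq_b1 _)) ?leq_maxr.
  move: c1_gt0; rewrite -theta_eq0 -nsize_gt0 /ncdeg.
  by move: (nsize (theta _)) (nsize (theta _)) => p p'; lia.
have Yw : (cmap (@tofrac C) y)@@w != 0 by rewrite coef_cmap tofrac_eq0.
have Y0 : a * q != 0 by apply: contraNneq Yw; rewrite YE => ->; rewrite nccoef0.
have q0 : q != 0 by apply: contraNneq Y0 => ->; rewrite mulr0.
have [mq [wq [wleq lq]]] := weight_exists v 1 q0.
have [wY rY] := weightM vM vN vD wa la wleq lq; rewrite -YE in wY rY.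
have n2_le : ncdeg c2 <= r%:Z + mq.
  rewrite c12; apply: le_trans (reaches_wle wY (conj Yw erefl)).
  by rewrite coef_cmap v_tofrac // sw mul1n lerD2r.
have [Yx xE] := rY; set x := u ++ wq in Yx xE.
have rx : (r <= size x)%N by rewrite size_cat su leq_addr.
(* Beyond length [delta] only [r1] contributes, with constants: the weight at [x] would be its
   length, less than the degree of [c1]. *)
rewrite (leq_trans rx) // leqNgt; apply/negP => dx.
have x0 : x != [::] by rewrite -size_eq0 -lt0n (leq_trans _ dx).
have yx : y@@x = iota r1@@x.
  by rewrite coef_y // [h@@x]coef_nsize ?sh // rmorph0 mulr0 addr0.
move: Yx; rewrite coef_cmap yx tofrac_eq0 iota_eq0 => r1x.
have := coef_neq0_size r1x; move: xE hlt n2_le c1_gt0.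
rewrite coef_cmap yx v_iota // c12 mul1n /ncdeg.
clear; move: (nsize _) (nsize _) (size x) => p p' sx; lia.
Qed.

(* A coefficient of degree at most r - 1 < delta has degree at most 0. *)
Lemma constant_coefficients : exists a b r s t, [/\ S c1 = a * b, a = S c1 * s + S c2 * t,
  nsize a = r.+1, (r <= delta)%N & forall w, w != [::] -> exists e, a@@w = (iota e)%:F].
Proof.
have S0 := opdiff_neq0 c1_gt0.
have c2_gt0 : 0 < ncdeg c2 by move: c1_gt0; rewrite c12; lia.
have S0' := opdiff_neq0 c2_gt0.
have Scomm : S c1 * S c2 = S c2 * S c1.
  by apply: cmap_comm; apply: opdiffC.
have [a [b [b' [s [t [v0 [ab ab' aE [bv sb]]]]]]]] :=
  normalized_left_factor Scomm (nc_mulf_neq0 S0 S0').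
have [r [u [sa wa la su]]] := left_factor_weight ab bv sb.
have r_le : (r <= delta)%N.
  exact: (left_factor_size ab'
    (ex_intro _ b ab) wa la su).
exists a, b, r, s, t; split; [exact: ab|exact: aE|exact: sa|exact: r_le|move=> w w0].
have : vle a@@w 0.
  apply: (v_gap) (wa w) _.
  rewrite mul1n; move: r_le delta_gt0 w0; rewrite -size_eq0.
  by move: (size w) => n; lia.
case/residue => e le; exists e.
have [c [c0 cP]] : exists c, c != 0 /\ forall u (z : C) n, exists e,
    c%:F * (a@@u - z%:F) ^+ n = e%:F.
  apply: powers_bounded bv => u'; exists (opdiff c1)@@u'.
  by rewrite -ab coef_cmap.
exact: (integral_const c0 le (cP w (iota e))).
Qed.

(* Left substitution kills the right ideal containing a, which turns a = h + scalar
   into theta c * h = - theta x0. *)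
Lemma small_commuting : exists h, [/\ (1 < nsize h)%N, (nsize h <= delta.+1)%N &
  forall x, h * theta x = theta x * h].
Proof.
have [a [b [r [s [t [ab aE sa r_le a_const]]]]]] := constant_coefficients.
have [gam gamP] : exists gam : seq I -> k, forall w, w != [::] -> a@@w = (iota (gam w))%:F.
  have ex w : exists e, w != [::] -> a@@w = (iota e)%:F.
    by have [->|/a_const[e ->]] := eqVneq w [::]; [exists 0 | exists e].
  exists (fun w => proj1_sig (constructive_indefinite_description _ (ex w))) => w.
  by case: constructive_indefinite_description.
pose h : freealg I k := \sum_(w <- words a | w != [::]) ncmon (gam w) w.
have coef_h w : w != [::] -> (iota h@@w)%:F = a@@w.
  move=> w0; rewrite nccoef_sum big_mkcond.
  have [wa|wa] := boolP (w \in words a); last first.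
    rewrite big1_seq => [|u /andP[_ ua]].
      by move: wa; rewrite mem_words negbK !rmorph0 => /eqP.
    case: ifP => // _; rewrite coef_mon; case: eqP => // uw; by rewrite -uw ua in wa.
  rewrite (bigD1_seq w) ?words_uniq //= w0 coef_mon eqxx mulr1n big1 ?addr0 ?gamP // => u uw.
  by case: ifP => // _; rewrite coef_mon (negPf uw).
have h_nil : h@@[::] = 0.
  by rewrite nccoef_sum big1 // => w /negPf w0; rewrite coef_mon w0.
have [cs [s' [cs0 sE]]] := common_denominator_nc s.
have [ct [t' [ct0 tE]]] := common_denominator_nc t.
pose X := opdiff c1 * (ncC ct * s') + opdiff c2 * (ncC cs * t').
have XE : ncC (cs * ct)%:F * a = cmap (@tofrac C) X.
  rewrite tofracM ncCM; apply: (clear_denominators (F := cmap (@tofrac C))) sE tE aE.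
  - exact: ncC_comm.
  - exact: ncC_comm.
  - exact: cmapC.
  - exact: cmapC.
have lsX : lsub theta X = 0 by rewrite /X raddfD /= 2?lsub_kill // addr0.
clearbody X; pose x0 := X@@[::]; have c0 : cs * ct != 0 by rewrite mulf_neq0.
move: (cs * ct) c0 XE => c c0 XE.
have XE' : X = ncC c * cmap iota h + ncC x0.
  apply/ncP => w; rewrite nccoefD nccoefCM coef_cmap nccoefC.
  have [->|w0] := eqVneq w [::]; first by rewrite h_nil rmorph0 mulr0 add0r mulr1n.
  rewrite mulr0n addr0; apply: tofrac_inj; rewrite tofracM coef_h // -nccoefCM XE.
  by rewrite coef_cmap.
have ch : theta c * h = - theta x0.
  have := congr1 (lsub theta) XE'.
  rewrite lsX raddfD /= lsubCM lsub_cmap // -[ncC x0]mulr1 lsubCM.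
  rewrite -(rmorph1 (cmap iota)) lsub_cmap // mulr1.
  by move/esym/eqP; rewrite addr_eq0 => /eqP.
have tc0 : theta c != 0 by rewrite theta_eq0.
exists h; split=> [||x].
- rewrite ltnNge; apply/negP => /nsize_le1P[e hE].
  have h0 : h = 0 by move: h_nil; rewrite hE nccoefC mulr1n => ->; rewrite rmorph0.
  move: ch; rewrite h0 mulr0 => /eqP; rewrite eq_sym oppr_eq0 theta_eq0 => /eqP x00.
  move: XE; rewrite XE' h0 x00 !rmorph0 mulr0 addr0 rmorph0 => /eqP.
  rewrite nc_mulf_eq0 -nsize_eq0 nsizeC tofrac_eq0 c0 /= => /eqP a0.
  by move: sa; rewrite a0 nsize0.
- apply/nsizeP => w sw; apply/eqP.
  have w0 : w != [::] by apply: contraTneq sw => ->.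
  rewrite -iota_eq0 -tofrac_eq0 coef_h //.
  by rewrite coef_nsize // sa (leq_trans _ sw).
(* Both [theta c] and [theta c * h] commute with [theta x]; cancelling [theta c] on the left gives
   the same for [h]. *)
- apply: (nc_mulfI tc0); rewrite !mulrA (theta_comm c x) ch -(mulrA (theta x)) ch.
  by rewrite mulNr mulrN theta_comm.
Qed.

End SmallestGap.

Lemma ncdegX x n : x != 0 -> ncdeg (x ^+ n) = (n * (nsize (theta x)).-1)%N.
Proof.
move=> x0; elim: n => [|n IHn].
  by rewrite expr0 mul0n -(rmorph1 iota) (ncdeg_iota).
by rewrite exprS ncdegM ?expf_neq0 // IHn mulSn PoszD.
Qed.

(** Bezout exponents realize the gcd as a difference of degrees of powers of [x] and [y], so the
    smallest positive difference is at most the gcd. *)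
Lemma commuting_gcd_degree (x y : C) :
  (1 < nsize (theta x))%N -> (1 < nsize (theta y))%N ->
  exists h, [/\ (1 < nsize h)%N,
    (nsize h <= (gcdn (nsize (theta x)).-1 (nsize (theta y)).-1).+1)%N &
    forall z, h * theta z = theta z * h].
Proof.
move=> x1 y1; set g := gcdn _ _.
have x0 : x != 0 by rewrite -theta_eq0 -nsize_gt0 ltnW.
have y0 : y != 0 by rewrite -theta_eq0 -nsize_gt0 ltnW.
pose P n := (0 < n)%N /\ exists c1 c2, [/\ c1 != 0, c2 != 0 & ncdeg c2 = ncdeg c1 + n%:Z].
have dx : (0 < (nsize (theta x)).-1)%N by rewrite -ltnS prednK // ltnW.
have Pg : P g.
  split; first by rewrite gcdn_gt0 dx.
  have [p q pq _] := egcdnP (nsize (theta y)).-1 dx.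
  exists (y ^+ q), (x ^+ p); rewrite !expf_neq0 //; split=> //.
  by rewrite !ncdegX // pq PoszD.
have [delta [[delta_gt0 [c1 [c2 [c10 c20 c12]]]] delta_le delta_min]] := least_nat Pg.
(* Multiplying both elements by [x] makes the degree of the first positive and keeps the
   difference. *)
have [|||h [h1 hd hC]] := @small_commuting (c1 * x) _ (c2 * x) delta delta_gt0 _ _.
- by rewrite ncdegM // ltr_wpDl // ncdeg_ge0.
- by rewrite !ncdegM // c12 addrAC.
- move=> a b a0 b0 ab; have ba : (0 < `|ncdeg b - ncdeg a|)%N.
    by rewrite absz_gt0 subr_eq0 gt_eqF.
  rewrite addrC -lerBrDr -[leRHS]gtz0_abs ?subr_gt0 // lez_nat.
  apply: delta_min; split=> //; exists a, b; split=> //.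
  by rewrite gtz0_abs ?subr_gt0 // addrC subrK.
- by exists h; split=> //; apply: leq_trans hd _.
Qed.

End CommutativeSubring.

(** * The bicommutant of two commuting elements *)

Section Bicommutant.
Variables (I : choiceType) (k : fieldType) (f g : freealg I k).
Local Notation R := (freealg I k).
Implicit Types (x y h : R).

(** When [f] and [g] commute, this condition defines a commutative subring containing [k], [f] and
    [g], to which the preceding results apply. *)
Definition bicommutes x := forall h, h * f = f * h -> h * g = g * h -> h * x = x * h.
Definition bicommb : pred R :=
  fun x => if excluded_middle_informative (bicommutes x) then true else false.

Lemma bicommP x : reflect (bicommutes x) (x \in bicommb).
Proof. by rewrite unfold_in /bicommb; case: excluded_middle_informative => h; constructor. Qed.

Fact bicomm_subring : subring_closed bicommb.
Proof.
split=> [|x y /bicommP xP /bicommP yP|x y /bicommP xP /bicommP yP].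
- by apply/bicommP => h _ _; rewrite mulr1 mul1r.
- by apply/bicommP => h hf hg; rewrite mulrBr mulrBl (xP h) ?(yP h).
- by apply/bicommP => h hf hg; rewrite mulrA (xP h) // -mulrA (yP h) // mulrA.
Qed.

HB.instance Definition _ := GRing.isSubringClosed.Build R bicommb bicomm_subring.

Record bicommutant := Bicommutant { bicomm_val : R; _ : bicomm_val \in bicommb }.
HB.instance Definition _ := [isSub for bicomm_val].
HB.instance Definition _ := [Choice of bicommutant by <:].
HB.instance Definition _ := [SubChoice_isSubNzRing of bicommutant by <:].

Lemma bicomm_valM (x y : bicommutant) : \val (x * y) = \val x * \val y.
Proof. exact: rmorphM. Qed.

Hypothesis fg : f * g = g * f.

Lemma bicomm_comm x y : bicommutes x -> bicommutes y -> x * y = y * x.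
Proof.
by move=> xP yP; apply: yP; [rewrite -(xP f) | rewrite -(xP g)]; rewrite // fg.
Qed.

Lemma bicomm_f : f \in bicommb. Proof. exact/bicommP. Qed.
Lemma bicomm_g : g \in bicommb. Proof. exact/bicommP. Qed.
Lemma bicomm_C c : ncC c \in bicommb.
Proof. by apply/bicommP => h _ _; rewrite ncC_comm. Qed.

Definition bicomm_const c : bicommutant := Bicommutant (bicomm_C c).

Fact bicomm_const_additive : additive bicomm_const.
Proof. by move=> c e; apply: val_inj; rewrite /= !rmorphB. Qed.
HB.instance Definition _ :=
  GRing.isAdditive.Build k bicommutant bicomm_const bicomm_const_additive.

Fact bicomm_const_multiplicative : multiplicative bicomm_const.
Proof.
split=> [c e|]; apply: val_inj; last exact: (rmorph1 ncC).
by rewrite [RHS]bicomm_valM; exact: (rmorphM ncC).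
Qed.
HB.instance Definition _ :=
  GRing.isMultiplicative.Build k bicommutant bicomm_const bicomm_const_multiplicative.

End Bicommutant.

Section BicommutantDomain.
Variables (I : choiceType) (k : fieldType) (f g : freealg I k).
Hypothesis fg : f * g = g * f.

(** The commutation proof is a parameter of the type, so that the commutative structure can be
    attached to it. *)
Definition bicomm_domain (_ : f * g = g * f) : Type := bicommutant f g.
Local Notation C := (bicomm_domain fg).

HB.instance Definition _ := GRing.NzRing.on C.

Fact bicomm_mulC : commutative (@GRing.mul C).
Proof.
move=> x y; apply: val_inj; rewrite [LHS]bicomm_valM [RHS]bicomm_valM.
by apply: (bicomm_comm fg); apply/bicommP/valP.
Qed.
HB.instance Definition _ := GRing.PzRing_hasCommutativeMul.Build C bicomm_mulC.

(** By additivity of degrees, only the nonzero constants are invertible. *)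
Let unit : pred C := fun x => nsize (bicomm_val x) == 1%N.
Let inv (x : C) : C :=
  if unit x then bicomm_const f g ((bicomm_val x)@@[::])^-1 else x.

Fact bicomm_mulVx : {in unit, left_inverse 1 inv *%R}.
Proof.
move=> x ux; rewrite /inv (ux : unit x); apply: val_inj; rewrite [LHS]bicomm_valM /=.
have /nsize_le1P[c xc] : (nsize (bicomm_val x) <= 1)%N by rewrite (eqP ux).
have c0 : c != 0 by move: (eqP ux); rewrite xc nsizeC; case: eqP.
by rewrite xc nccoefC mulr1n -rmorphM mulVf ?rmorph1.
Qed.

Fact bicomm_unitPl (x y : C) : y * x = 1 -> unit x.
Proof.
move/(congr1 (@bicomm_val _ _ f g)); rewrite [LHS]bicomm_valM => yx.
have {}yx : bicomm_val y * bicomm_val x = 1 := yx.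
have [x0 y0] : bicomm_val x != 0 /\ bicomm_val y != 0.
  by split; apply: contraTneq (oner_neq0 (freealg I k)) => e; rewrite negbK -[1]yx e ?mulr0 ?mul0r.
have := nsizeM y0 x0; rewrite yx -(rmorph1 ncC) nsizeC oner_eq0 => /esym.
move: x0 y0; rewrite /unit -!nsize_gt0; move: (nsize _) (nsize _) => [|p] [|q] // _ _.
by rewrite addSn addnS /= => -[/eqP]; rewrite addn_eq0 => /andP[_ /eqP ->].
Qed.

Fact bicomm_inv_out : {in [predC unit], inv =1 id}.
Proof. by move=> x /negPf ux; rewrite /inv (ux : unit x = false). Qed.

HB.instance Definition _ := GRing.ComNzRing_hasMulInverse.Build C
  bicomm_mulVx bicomm_unitPl bicomm_inv_out.

Fact bicomm_integral (x y : C) : x * y = 0 -> (x == 0) || (y == 0).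
Proof.
move/(congr1 (@bicomm_val _ _ f g)); rewrite [LHS]bicomm_valM => xy.
have : bicomm_val x * bicomm_val y == 0 by rewrite xy.
by rewrite nc_mulf_eq0 => /orP[] /eqP e; apply/orP; [left|right]; apply/eqP/val_inj.
Qed.
HB.instance Definition _ := GRing.ComUnitRing_isIntegral.Build C bicomm_integral.

Definition bicomm_incl : C -> freealg I k := \val.
HB.instance Definition _ := GRing.RMorphism.on bicomm_incl.

Lemma commuting_degree_gcd : (1 < nsize f)%N -> (1 < nsize g)%N ->
  exists h, [/\ (1 < nsize h)%N, (nsize h <= (gcdn (nsize f).-1 (nsize g).-1).+1)%N,
    h * f = f * h & h * g = g * h].
Proof.
move=> f1 g1.
have theta_iota c : bicomm_incl (bicomm_const f g c) = ncC c by [].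
have theta_inj : injective bicomm_incl by apply: val_inj.
have [h [h1 hd hC]] := commuting_gcd_degree theta_iota theta_inj
  (x := Bicommutant (bicomm_f f g)) (y := Bicommutant (bicomm_g f g)) f1 g1.
exists h; split=> //; first exact: (hC (Bicommutant (bicomm_f f g))).
exact: (hC (Bicommutant (bicomm_g f g))).
Qed.

End BicommutantDomain.

(** * Centralizers of noncomposite polynomials *)

Section CentralizerOfNoncomposite.
Variables (I : choiceType) (k : fieldType).
Implicit Types (f g h : freealg I k) (p q : {poly k}).

Lemma nceval_comp f q p : nceval f (q \Po p) = nceval (nceval f p) q.
Proof.
elim/poly_ind: q => [|q c IHq]; first by rewrite comp_poly0 !raddf0.
rewrite comp_poly_MXaddC (ncevalD _ (_ * _)) (ncevalM _ _ p) ncevalC IHq.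
by rewrite (ncevalD _ (_ * _)) ncevalMX ncevalC.
Qed.

Lemma same_degree_division g1 g2 : g1 * g2 = g2 * g1 -> nsize g1 = nsize g2 -> g1 != 0 ->
  exists e : k, (nsize (g2 - g1 * ncC e)%R < nsize g2)%N.
Proof.
move=> g12 sg g10; have [h hlt] := division (esym g12) g10 g10.
suff [e hE] : exists e, h = ncC e by exists e; rewrite -hE -sg.
apply/nsize_le1P; have [->|h0] := eqVneq h 0; first by rewrite nsize0.
have := nsizeM g10 h0; have := nsizeB g2 (g2 - g1 * h).
rewrite opprB addrCA subrr addr0; move: hlt h0 g10; rewrite -!nsize_gt0 -sg.
by move: (nsize g1) (nsize h) (nsize (g1 * h)) (nsize (_ - _)) => a b c d; lia.
Qed.

Lemma nsizeX h n : h != 0 -> nsize (h ^+ n) = (n * (nsize h).-1).+1.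
Proof.
move=> h0; elim: n => [|n IHn]; first by rewrite expr0 -(rmorph1 ncC) nsizeC oner_eq0.
have hn0 : h ^+ n != 0 by rewrite -nsize_gt0 IHn.
by rewrite exprS nsizeM // IHn addnS /= mulSn -addSn prednK // nsize_gt0.
Qed.

(** Some nonconstant element commuting with [g] and [h] has degree at most the gcd of theirs; by
    minimality the degree of [h] divides that of [g]. A scalar multiple of a power of [h] then
    cancels the top of [g]. *)
Lemma minimal_degree_generates h g : (1 < nsize h)%N -> g * h = h * g ->
  (forall x, x * g = g * x -> x * h = h * x -> (1 < nsize x)%N -> (nsize h <= nsize x)%N) ->
  exists q, g = nceval h q.
Proof.
move=> h1; have h0 : h != 0 by rewrite -nsize_gt0 ltnW.
have [n] := ubnP (nsize g); elim: n g => // n IHn g gn gh hmin.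
have [/nsize_le1P[c ->]|g1] := leqP (nsize g) 1; first by exists c%:P; rewrite ncevalC.
have [x [x1 xd xg xh]] := commuting_degree_gcd gh g1 h1.
have gcd_h : gcdn (nsize g).-1 (nsize h).-1 = (nsize h).-1.
  have hd0 : (0 < (nsize h).-1)%N by case: (nsize h) h1 => [|[]].
  apply/eqP; rewrite eqn_leq (dvdn_leq hd0 (dvdn_gcdr _ _)) andTb.
  have := leq_trans (hmin x xg xh x1) xd; move: (gcdn _ _) => m.
  by case: (nsize h) h1.
have /dvdnP[j gj] : ((nsize h).-1 %| (nsize g).-1)%N by rewrite -gcd_h dvdn_gcdl.
have hj0 : h ^+ j != 0 by rewrite -nsize_gt0 nsizeX.
have hjg : h ^+ j * g = g * h ^+ j.
  by elim: j {gj hj0} => [|j IHj]; rewrite ?expr0 ?mulr1 ?mul1r // exprS -mulrA IHj !mulrA gh.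
have [|e elt] := same_degree_division hjg _ hj0.
  by rewrite nsizeX // -gj prednK // ltnW.
have [||y yg yh y1|q qE] := IHn (g - h ^+ j * ncC e).
- by apply: leq_trans elt _; rewrite -ltnS.
- by rewrite mulrBl mulrBr gh -(mulrA (h ^+ j)) -ncC_comm !mulrA -exprSr exprS.
(* What commutes with [h] and with the difference commutes with [g], so the minimality of [h] is
   inherited. *)
- apply: (hmin y _ yh y1).
  rewrite -(subrK (h ^+ j * ncC e) g) mulrDr mulrDl yg; congr (_ + _).
  rewrite mulrA -[RHS]mulrA -[ncC e * y]ncC_comm mulrA; congr (_ * _).
  by elim: (j) => [|i IHi]; rewrite ?expr0 ?mulr1 ?mul1r // exprS mulrA yh -mulrA IHi mulrA.
exists (q + e%:P * 'X^j); rewrite (ncevalD _ q) -qE.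
have -> : nceval h (e%:P * 'X^j) = h ^+ j * ncC e.
  by rewrite ncevalM ncevalC rmorphXn /= ncevalX ncC_comm.
by rewrite subrK.
Qed.

Lemma noncomposite_centralizer f : (1 < nsize f)%N ->
  (forall h p, (2 < size p)%N -> f <> nceval h p) ->
  forall g, g * f = f * g -> exists q, g = nceval f q.
Proof.
move=> f1 noncomp g gf.
have [_ [[h [h1 hf <-]] _ hmin]] := @least_nat
  (fun n => exists h, [/\ (1 < nsize h)%N, h * f = f * h & nsize h = n]) (nsize f)
  (ex_intro _ f (And3 f1 (erefl _) (erefl _))).
have {}hmin x : x * f = f * x -> (1 < nsize x)%N -> (nsize h <= nsize x)%N.
  by move=> xf x1; apply: hmin; exists x.
have [|p fE] := minimal_degree_generates h1 (esym hf).
  by move=> x xf _; apply: hmin.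
have p2 : (size p <= 2)%N.
  by rewrite leqNgt; apply/negP => /(noncomp h p); apply; exact: fE.
have pE : p = (p`_1)%:P * 'X + (p`_0)%:P.
  apply/polyP => -[|[|i]]; rewrite !coefE ?mulr0 ?add0r ?mulr1 ?addr0 //.
  by rewrite nth_default // (leq_trans p2).
have fh : f = ncC p`_1 * h + ncC p`_0.
  by rewrite {1}fE {1}pE (ncevalD _ (_ * _)) ncevalMX !ncevalC.
have p10 : p`_1 != 0.
  apply: contraTneq f1 => p10; rewrite fh p10 rmorph0 mul0r add0r -leqNgt.
  by rewrite nsizeC leq_b1.
(* Inverting the linear polynomial makes [h] a polynomial in [f], so [f] and [h] have the same
   centralizer. *)
have hE : h = nceval f (((p`_1)^-1)%:P * ('X - (p`_0)%:P)).
  rewrite ncevalM ncevalC raddfB /= ncevalX ncevalC {1}fh addrK mulrA -rmorphM mulVf //.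
  by rewrite rmorph1 mul1r.
have gh : g * h = h * g by rewrite hE nceval_comm.
have [|q ->] := minimal_degree_generates h1 gh.
  by move=> x _ xh; apply: hmin; rewrite fE nceval_comm.
by exists (q \Po (((p`_1)^-1)%:P * ('X - (p`_0)%:P))); rewrite nceval_comp -hE.
Qed.

End CentralizerOfNoncomposite.

(** * Transfer to the notions of the statement *)

Section Transfer.
Variables (k : fieldType) (d : nat).
Implicit Types (g h : ncpoly k d) (p : {poly k}).

Lemma nonconstantP g : nonconstant g <-> (1 < nsize (of_malg g))%N.
Proof.
rewrite /nonconstant ltnNge; split=> [nc|/nsize_le1P nc [c gE]].
  apply/nsize_le1P => -[c gE]; apply: nc; exists c.
  exact: (can_inj (@of_malgK _ _)) gE.
by apply: nc; exists c; rewrite gE.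
Qed.

Lemma factors_reducible g : factors g -> nc_reducible (of_malg g).
Proof.
case=> [g1 [g2 [/nonconstantP n1 /nonconstantP n2 ->]]].
by exists (of_malg g1), (of_malg g2); split; [exact: n1|exact: n2|exact: rmorphM].
Qed.

Lemma of_malg_in_alg (c : k) : of_malg (in_alg (ncpoly k d) c) = ncC c.
Proof.
by rewrite /ncC -[c%:MP]mulr1 mul_malgC.
Qed.

Lemma of_malg_nc_eval p h : of_malg (nc_eval p h) = nceval (of_malg h) p.
Proof.
rewrite /nc_eval /nceval (@horner_coef_wide _ (size p)) ?size_poly //.
rewrite [RHS](@horner_coef_wide _ (size p)) ?size_poly // raddf_sum.
apply: eq_bigr => i _; rewrite /= rmorphM rmorphXn; congr (_ * _).
rewrite !coef_poly ltn_ord; exact: of_malg_in_alg.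
Qed.

End Transfer.

Lemma of_malg_nc_map (k K : fieldType) (iota : {rmorphism k -> K}) d (g : ncpoly k d) :
  of_malg (nc_map iota g) = cmap iota (of_malg g).
Proof.
rewrite [of_malg g]ncmonE /words big_map of_malgK.
rewrite /nc_map mmapE !raddf_sum /=; apply: eq_bigr => -[w] _ /=.
rewrite rmorphM.
apply/ncP => u; rewrite nccoefCM coef_cmap !coef_mon rmorphMn /= /nccoef of_malgK.
by rewrite mulrnAr mulr1.
Qed.

(* kbar together with iota is an algebraic closure of k. *)
Theorem theorem1 (k : fieldType) (kbar : closedFieldType)
    (iota : {rmorphism k -> kbar})
    (alg_kbar : forall z : kbar, algebraicOver iota z)
    (d : nat) (f : ncpoly k d) (f_nonconst : nonconstant f)
    (f_noncomp : ~ composite f) :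
  exists s : seq kbar, forall lambda : kbar, lambda \notin s ->
    nc_irreducible (nc_map iota f - lambda%:MP).
Proof.
apply: NNPP => nos.
have inf (r : seq kbar) : exists lam, lam \notin r /\
    nc_reducible (cmap iota (of_malg f) - ncC lam).
  apply: NNPP => nolam; apply: nos; exists r => lam lr /factors_reducible fac.
  apply: nolam; exists lam; split; first exact: lr.
  by move: fac; rewrite raddfB /= of_malg_nc_map.
have [g [gf gnot]] := infinitely_many_reducible_shifts inf.
have f1 : (1 < nsize (of_malg f))%N by apply/nonconstantP.
have noncomp h (p : {poly k}) : (2 < size p)%N -> of_malg f <> nceval h p.
  move=> p2 fE; apply: f_noncomp; split; first exact: f_nonconst.
  exists (to_malg h), p; split; first exact: p2.
  apply: (can_inj (@of_malgK _ _)); rewrite of_malg_nc_eval to_malgK; exact: fE.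
have [q gE] := centralizer_scalar_extension (noncomposite_centralizer f1 noncomp) gf.
exact: gnot q gE.
Qed.
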